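(* Let $(V,g)$ and $(W,h)$ be Riemannian manifolds (not necessarily compact or complete) of dimensions $v,w\geq 3$, and let $(M,G)=(V\times W,\,g+h)$ be the Riemannian product, of dimension $m=v+w$. Assume that $\mu(V,g)\geq 0$, $\mu(W,h)\geq 0$, and that $$\frac{s^g+s^h}{a_m}\;\geq\;\frac{s^g}{a_v}+\frac{s^h}{a_w}$$ holds pointwise on $V\times W$. Then $$\mu(M,G)\;\geq\;\frac{m\,a_m}{(v\,a_v)^{\frac{v}{m}}(w\,a_w)^{\frac{w}{m}}}\;\mu(V,g)^{\frac{v}{m}}\,\mu(W,h)^{\frac{w}{m}},$$ or, equivalently, $\nu(M,G)\geq \nu(V,g)\,\nu(W,h)$.
   Context: For an integer $n\geq 3$ set $a_n=\frac{4(n-1)}{n-2}$ and $p_n=\frac{2n}{n-2}$. For a Riemannian manifold $(N,k)$ (without boundary) let $s^k$ denote the scalar curvature and $dv^k$ the volume measure; on the product $V\times W$, $s^g$ and $s^h$ are regarded as functions via the projections to $V$ and $W$. For a (possibly non-compact, possibly incomplete) Riemannian manifold $(N,k)$ of dimension $n\geq 3$, the conformal Yamabe constant is $$\mu(N,k)=\inf_{u\in C_c^\infty(N),\,u\not\equiv 0}\ \frac{\int_N\left(a_n|du|_k^2+s^k u^2\right)dv^k}{\left(\int_N|u|^{p_n}\,dv^k\right)^{2/p_n}}\in[-\infty,\infty),$$ where $C_c^\infty(N)$ is the space of compactly supported smooth real functions. If $\mu(N,k)\geq 0$, set $\nu(N,k)=\left(\frac{\mu(N,k)}{n\,a_n}\right)^n$.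 *)

(* Defs.v *)
From HB Require Import structures.
From mathcomp Require Import all_boot all_order all_algebra.
From mathcomp Require Import all_classical all_reals all_analysis.

Set Implicit Arguments.
Unset Strict Implicit.
Unset Printing Implicit Defensive.

Import Order.TTheory GRing.Theory Num.Theory.
Import numFieldNormedType.Exports.

Local Open Scope classical_set_scope.
Local Open Scope ring_scope.

Section EuclideanSpace.
Context {R : realType}.

Definition partial n (i : 'I_n) (f : 'rV[R]_n -> R) : 'rV[R]_n -> R :=
  fun y => 'D_(delta_mx 0 i) f y.

Definition partials n (s : seq 'I_n) (f : 'rV[R]_n -> R) : 'rV[R]_n -> R :=
  foldr (@partial n) f s.

(* C^oo on the open set D: all iterated partial derivatives exist and are
   continuous at the points of D; the values of f outside D are irrelevant. *)
Definition smooth_on n (D : set 'rV[R]_n) (f : 'rV[R]_n -> R) : Prop :=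
  forall (s : seq 'I_n) (y : 'rV[R]_n), D y ->
    {for y, continuous (partials s f)} /\
    forall i : 'I_n, derivable (partials s f) y (delta_mx 0 i).

(* Integral over R^n with respect to Lebesgue measure, as an iterated integral;
   only used for nonnegative Borel functions, where Tonelli's theorem applies. *)
Fixpoint rV_integral (n : nat) : ('rV[R]_n -> \bar R) -> \bar R :=
  match n with
  | 0 => fun f => f 0
  | k.+1 => fun f =>
      (\int[@lebesgue_measure R]_t
        rV_integral (fun y : 'rV[R]_k => f (row_mx (t%:M : 'rV[R]_1) y)))%E
  end.

Section Curvature.
Variables (n : nat) (g : 'rV[R]_n -> 'M[R]_n).

Definition christoffel (k i j : 'I_n) (y : 'rV[R]_n) : R :=
  2^-1 * \sum_(l < n) invmx (g y) k l *
    (partial i (fun z => g z j l) y + partial j (fun z => g z i l) y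
     - partial l (fun z => g z i j) y).

Definition ricci (i j : 'I_n) (y : 'rV[R]_n) : R :=
  \sum_(k < n) (partial k (christoffel k i j) y
                - partial j (christoffel k i k) y)
  + \sum_(k < n) \sum_(l < n)
      (christoffel k k l y * christoffel l i j y
       - christoffel k j l y * christoffel l i k y).

Definition coord_scalar_curvature (y : 'rV[R]_n) : R :=
  \sum_(i < n) \sum_(j < n) invmx (g y) i j * ricci i j y.

End Curvature.

End EuclideanSpace.

(* A nonempty topological space with an atlas (not necessarily maximal) and, for each
   chart, the matrix of a metric as a function of the coordinates.  The map
   [param i] is the inverse of [chart i]; only the values of [chart i] on
   [dom i], and those of [param i] and [metric i] on the image of [chart i],
   are meaningful. *)
Record riemannian_data (R : realType) (n : nat) := RiemannianData {
  space :> ptopologicalType;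
  chart_index : Type;
  dom : chart_index -> set space;
  chart : chart_index -> space -> 'rV[R]_n;
  param : chart_index -> 'rV[R]_n -> space;
  metric : chart_index -> 'rV[R]_n -> 'M[R]_n
}.

Section Riemannian.
Context {R : realType} {n : nat}.
Implicit Type N : riemannian_data R n.

Definition transition N (i j : chart_index N) : 'rV[R]_n -> 'rV[R]_n :=
  chart j \o param i.

Definition is_chart N (i : chart_index N) : Prop :=
  [/\ open (dom i), open (chart i @` dom i),
      forall x, dom i x -> param i (chart i x) = x,
      forall x, dom i x -> {for x, continuous (chart i)} &
      forall y, (chart i @` dom i) y -> {for y, continuous (param i)}].

Definition is_smooth_manifold N : Prop :=
  [/\ hausdorff_space N, @second_countable N,
      \bigcup_i @dom R n N i = setT,
      forall i : chart_index N, is_chart i &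
      forall (i j : chart_index N) (k : 'I_n),
        smooth_on (chart i @` (dom i `&` dom j))
                  (fun y => transition i j y 0 k)].

(* The Jacobian ['J f y] acts on row vectors from the right: the derivative of
   [f] at [y] in direction [xi] is [xi *m 'J f y]. *)
Definition is_riemannian_metric N : Prop :=
  [/\ forall (i : chart_index N) (k l : 'I_n),
        smooth_on (chart i @` dom i) (fun y => metric i y k l),
      forall (i : chart_index N) y, (chart i @` dom i) y ->
        (metric i y)^T = metric i y,
      forall (i : chart_index N) y, (chart i @` dom i) y ->
        forall xi : 'rV[R]_n, xi != 0 ->
          0 < (xi *m metric i y *m xi^T) 0 0 &
      forall (i j : chart_index N) y, (chart i @` (dom i `&` dom j)) y ->
        metric i y = 'J (transition i j) y *m metric j (transition i j y)
                       *m ('J (transition i j) y)^T].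

Definition is_riemannian_manifold N : Prop :=
  is_smooth_manifold N /\ is_riemannian_metric N.

Definition borel N := g_sigma_algebraType (@open N).

(* dv = sqrt (det g) dy in every chart.  On a Riemannian manifold exactly one
   Borel measure has this property. *)
Definition is_volume_measure N (vol : {measure set (borel N) -> \bar R}) :
    Prop :=
  forall (i : chart_index N) (A : set (borel N)), measurable A -> A `<=` dom i ->
    vol A = rV_integral (fun y =>
      (\1_(chart i @` A) y * Num.sqrt (\det (metric i y)))%:E).

(* The value does not depend on the chart, so that on a Riemannian manifold
   exactly one function has this property. *)
Definition is_scalar_curvature N (s : N -> R) : Prop :=
  forall (i : chart_index N) (x : N), dom i x ->
    s x = coord_scalar_curvature (metric i) (chart i x).

Definition smooth_function N (u : N -> R) : Prop :=
  forall i : chart_index N, smooth_on (chart i @` dom i) (u \o param i).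

Definition compactly_supported N (u : N -> R) : Prop :=
  compact (closure [set x | u x != 0]).

Definition coord_sqnorm_d N (u : N -> R) (i : chart_index N) (y : 'rV[R]_n) : R :=
  \sum_(k < n) \sum_(l < n) invmx (metric i y) k l *
    partial k (u \o param i) y * partial l (u \o param i) y.

(* |du|^2 at x, computed in a chart around x; the choice is immaterial. *)
Definition sqnorm_d N (u : N -> R) (x : N) : R :=
  xget 0 [set r | exists2 i : chart_index N,
                    dom i x & r = coord_sqnorm_d u i (chart i x)].

End Riemannian.

Section Yamabe.
Context {R : realType}.

Definition a_ (n : nat) : R := 4 * (n%:R - 1) / (n%:R - 2).

Definition p_ (n : nat) : R := 2 * n%:R / (n%:R - 2).

Context {n : nat}.
Variables (N : riemannian_data R n) (vol : {measure set (borel N) -> \bar R})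
          (s : N -> R).

Definition yamabe_quotient (u : N -> R) : R :=
  (\int[vol]_x (a_ n * sqnorm_d u x + s x * u x ^+ 2))
  / (\int[vol]_x (`|u x| `^ p_ n)) `^ (2 / p_ n).

Definition yamabe_constant : \bar R :=
  ereal_inf [set (yamabe_quotient u)%:E | u in
    [set u : N -> R | [/\ smooth_function u, compactly_supported u &
                          exists x, u x != 0]]].

(* Meaningful when the Yamabe constant is nonnegative. *)
Definition yamabe_nu : \bar R :=
  ((yamabe_constant * ((n%:R * a_ n)^-1)%:E) ^+ n)%E.

End Yamabe.

HB.instance Definition _ (X Y : ptopologicalType) := Pointed.on (X * Y)%type.

Section Product.
Context {R : realType} {v w : nat}.

Definition riemannian_product (V : riemannian_data R v)
    (W : riemannian_data R w) : riemannian_data R (v + w) :=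
  @RiemannianData R (v + w) (V * W)%type (chart_index V * chart_index W)%type
    (fun k => dom k.1 `*` dom k.2)
    (fun k x => row_mx (chart k.1 x.1) (chart k.2 x.2))
    (fun k y => (param k.1 (lsubmx y), param k.2 (rsubmx y)))
    (fun k y => block_mx (metric k.1 (lsubmx y)) 0 0 (metric k.2 (rsubmx y))).

End Product.

(* Main.v *)
(** Apply the Yamabe inequality of [V] to the slices [u (., y)] and integrate over [W];
    apply that of [W] to the slices [u (x, .)] and integrate over [V]. The hypothesis on
    the scalar curvatures bounds the energy of [u] on the product below by [a_m / a_v]
    times the first energy plus [a_m / a_w] times the second, hence by a positive
    combination of [A = int_W (int_V |u|^p_v)^(2/p_v)] and [B = int_V (int_W
    |u|^p_w)^(2/p_w)]. By the weighted arithmetic-geometric mean inequality with weights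
    [v/m] and [w/m] this dominates a multiple of [A^(v/m) B^(w/m)], and [A^(v/m)
    B^(w/m)] dominates the squared [L^p_m] norm of [u] by interpolation (Hoelder's and
    Minkowski's inequalities). *)
From HB Require Import structures.
Require Import Defs.
From mathcomp Require Import all_boot all_order all_algebra.
From mathcomp Require Import all_classical all_reals all_analysis.
From mathcomp Require Import measurable_realfun.
From mathcomp Require Import ring lra.

Set Implicit Arguments.
Unset Strict Implicit.
Unset Printing Implicit Defensive.

Import Order.TTheory GRing.Theory Num.Theory.
Import numFieldNormedType.Exports.

Local Open Scope classical_set_scope.
Local Open Scope ring_scope.

(** * Calculus on row vectors *)

(** The weights are dictated by 1/p_n = 1/2 - 1/n: it gives 1/p_m = (v/m)/p_v + (w/m)/2 and also
    1/p_m = (v/m)/2 + (w/m)/p_w, so the same weights interpolate the exponents in both variables.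
    The two mixed norms come with opposite orders of integration; Minkowski's inequality reverses
    one of them because p_w exceeds 2. Scaling A by m/v and B by m/w before taking the mean produces
    the constant of the theorem.

    Most of the work surrounds this argument. The measure on the product is known only through its
    densities in product charts, on the Borel sets of the product topology; it must be identified
    with the product measure before Tonelli and Fubini apply, by means of second countability and a
    decomposition into chart cells of finite volume. The integrals in the quotient are real-valued,
    so the energy densities, curvature included, are shown continuous and compactly supported, hence
    integrable. Finally, |du|^2 is defined through an arbitrary choice of chart, so its invariance
    has to precede its splitting along the factors. *)

Section Calculus.
Context {R : realType}.

Section C1.
Context {n : nat}.
Implicit Types (D : set 'rV[R]_n) (f g : 'rV[R]_n -> R).

(** A first-order class that is stable under the algebra building the Christoffel symbols from the
    metric. Once these symbols are C1, the Ricci coefficients, which involve one more derivative,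
    are continuous. *)
Definition C1_on D f := forall y, D y ->
  {for y, continuous f} /\
  forall i, derivable f y (delta_mx 0 i) /\ {for y, continuous (partial i f)}.

Lemma near_partial (i : 'I_n) f g y : (\forall z \near y, f z = g z) ->
  partial i f y = partial i g y.
Proof.
by move=> fg; rewrite /partial; apply: near_eq_derive => //.
Qed.

Lemma near_eq_continuous_at (T U : topologicalType) (f g : T -> U) (y : T) :
  (\forall z \near y, f z = g z) -> {for y, continuous f} -> {for y, continuous g}.
Proof.
move=> fg cf; rewrite /prop_for /continuous_at -(nbhs_singleton fg).
by apply: cvg_trans cf; exact: (near_eq_cvg (F := nbhs y)).
Qed.

Lemma C1_congr D f g : open D -> (forall y, D y -> f y = g y) ->
  C1_on D f -> C1_on D g.
Proof.
move=> oD fg C1f y Dy; have [cf df] := C1f _ Dy.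
have fgy z : D z -> \forall x \near z, f x = g x.
  by move=> Dz; have := open_nbhs_nbhs (conj oD Dz); apply: filterS.
split; first exact: (near_eq_continuous_at (fgy _ Dy) cf).
move=> i; have [di ci] := df i; split.
  exact: (near_eq_derivable (fgy _ Dy) di).
apply: near_eq_continuous_at ci; have := open_nbhs_nbhs (conj oD Dy).
by apply: filterS => z Dz; exact/near_partial/fgy.
Qed.

Lemma C1_cst D a : C1_on D (cst a).
Proof.
move=> y _; split; first exact: cst_continuous.
move=> i; split; first exact: derivable_cst.
have -> : partial i (cst a) = cst 0 by apply/funext => z; exact: derive_cst.
exact: cst_continuous.
Qed.

(** Differentiation rules identify a partial derivative with a formula only at points of [D];
    openness makes the identity hold near each point, so continuity of the formula passes to the
    derivative. *)
Lemma C1_open_partial D (op dop : ('rV[R]_n -> R)) i : open D ->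
  (forall y, D y -> partial i op y = dop y) ->
  forall y, D y -> {for y, continuous dop} -> {for y, continuous (partial i op)}.
Proof.
move=> oD od y Dy; apply: near_eq_continuous_at.
by have := open_nbhs_nbhs (conj oD Dy); apply: filterS => z Dz; rewrite od.
Qed.

Lemma C1_add D f g : open D -> C1_on D f -> C1_on D g ->
  C1_on D (fun y => f y + g y).
Proof.
move=> oD C1f C1g y Dy; split; first exact: (continuousD (C1f _ Dy).1 (C1g _ Dy).1).
move=> i; split; first exact: (derivableD ((C1f _ Dy).2 i).1 ((C1g _ Dy).2 i).1).
apply: (@C1_open_partial D _ (fun y => partial i f y + partial i g y)) => //.
  by move=> z Dz; rewrite /partial -deriveD//; [exact: ((C1f _ Dz).2 i).1|exact: ((C1g _ Dz).2 i).1].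
exact: (continuousD ((C1f _ Dy).2 i).2 ((C1g _ Dy).2 i).2).
Qed.

Lemma partialM f g i y : derivable f y (delta_mx 0 i) ->
  derivable g y (delta_mx 0 i) ->
  partial i (fun y => f y * g y) y = f y * partial i g y + g y * partial i f y.
Proof. by move=> df dg; rewrite /partial (deriveM df dg). Qed.

Lemma C1_mul D f g : open D -> C1_on D f -> C1_on D g ->
  C1_on D (fun y => f y * g y).
Proof.
move=> oD C1f C1g y Dy; split; first exact: (continuousM (C1f _ Dy).1 (C1g _ Dy).1).
move=> i; split; first exact: (derivableM ((C1f _ Dy).2 i).1 ((C1g _ Dy).2 i).1).
apply: (@C1_open_partial D _
  (fun y => f y * partial i g y + g y * partial i f y)) => //.
  by move=> z Dz; apply: partialM; [exact: ((C1f _ Dz).2 i).1|exact: ((C1g _ Dz).2 i).1].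
apply: continuousD; apply: continuousM.
- exact: (C1f _ Dy).1.
- exact: ((C1g _ Dy).2 i).2.
- exact: (C1g _ Dy).1.
- exact: ((C1f _ Dy).2 i).2.
Qed.

Lemma C1_inv D f : open D -> (forall y, D y -> f y != 0) -> C1_on D f ->
  C1_on D (fun y => (f y)^-1).
Proof.
move=> oD f0 C1f y Dy; split; first exact: (continuousV (f0 _ Dy) (C1f _ Dy).1).
move=> i; split; first exact: (derivableV (f0 _ Dy) ((C1f _ Dy).2 i).1).
apply: (@C1_open_partial D _ (fun y => - ((f y)^-1 * (f y)^-1) * partial i f y)) => //.
  move=> z Dz; rewrite /partial (deriveV (f0 _ Dz) ((C1f _ Dz).2 i).1).
  by rewrite -exprVn.
have cV := continuousV (f0 _ Dy) (C1f _ Dy).1.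
apply: continuousM; last exact: ((C1f _ Dy).2 i).2.
by apply: continuousN; apply: continuousM.
Qed.

Lemma C1_sum D (I : Type) (r : seq I) (P : pred I) (F : I -> 'rV[R]_n -> R) :
  open D -> (forall i, C1_on D (F i)) ->
  C1_on D (fun y => \sum_(i <- r | P i) F i y).
Proof.
move=> oD C1F; elim: r => [|j r ih].
  rewrite (_ : (fun y => _) = cst 0); first exact: C1_cst.
  by apply/funext => y; rewrite big_nil.
have -> : (fun y => \sum_(i <- j :: r | P i) F i y) = if P j then
    (fun y => F j y + \sum_(i <- r | P i) F i y) else
    (fun y => \sum_(i <- r | P i) F i y).
  by apply/funext => y; rewrite big_cons; case: (P j).
by case: (P j) => //; exact: (C1_add oD (C1F j) ih).
Qed.

Lemma C1_prod D (I : Type) (r : seq I) (P : pred I) (F : I -> 'rV[R]_n -> R) :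
  open D -> (forall i, C1_on D (F i)) ->
  C1_on D (fun y => \prod_(i <- r | P i) F i y).
Proof.
move=> oD C1F; elim: r => [|j r ih].
  rewrite (_ : (fun y => _) = cst 1); first exact: C1_cst.
  by apply/funext => y; rewrite big_nil.
have -> : (fun y => \prod_(i <- j :: r | P i) F i y) = if P j then
    (fun y => F j y * \prod_(i <- r | P i) F i y) else
    (fun y => \prod_(i <- r | P i) F i y).
  by apply/funext => y; rewrite big_cons; case: (P j).
by case: (P j) => //; exact: (C1_mul oD (C1F j) ih).
Qed.

Lemma C1_det D m (A : 'rV[R]_n -> 'M[R]_m) : open D ->
  (forall i j, C1_on D (fun y => A y i j)) -> C1_on D (fun y => \det (A y)).
Proof.
move=> oD C1A; apply: (C1_sum _ _ oD) => s; apply: (C1_mul oD); first exact: C1_cst.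
by apply: (C1_prod _ _ oD) => i; exact: C1A.
Qed.

(** Cramer's rule: the entries of the inverse are cofactors divided by the determinant, and both are
    polynomials in the entries of [A]. *)
Lemma C1_invmx D m (A : 'rV[R]_n -> 'M[R]_m) : open D ->
  (forall i j, C1_on D (fun y => A y i j)) ->
  (forall y, D y -> A y \in unitmx) ->
  forall i j, C1_on D (fun y => invmx (A y) i j).
Proof.
move=> oD C1A uA i j.
apply: (@C1_congr _ (fun y => (\det (A y))^-1 * \adj (A y) i j)) => //.
  by move=> y Dy; rewrite /invmx uA// !mxE.
apply: (C1_mul oD).
  apply: (C1_inv oD); last exact: C1_det.
  by move=> y /uA; rewrite unitmxE unitfE.
rewrite (_ : (fun y => _) = fun y => cofactor (A y) j i); last first.
  by apply/funext => y; rewrite mxE.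
apply: (C1_mul oD); first exact: C1_cst.
apply: (C1_det oD) => k l; rewrite (_ : (fun y => _) =
  fun y => A y (lift j k) (lift i l)) //.
by apply/funext => y; rewrite !mxE.
Qed.

Lemma smooth_C1 D f : smooth_on D f -> C1_on D f.
Proof.
move=> sf y Dy; split; first exact: (sf [::] y Dy).1.
by move=> i; split; [exact: (sf [::] y Dy).2|exact: (sf [:: i] y Dy).1].
Qed.

(** [partials] is a right fold, so the last index of the list is differentiated first; this is why
    [i] is appended with [rcons]. *)
Lemma smooth_partial D f i : smooth_on D f -> smooth_on D (partial i f).
Proof.
move=> sf s y Dy; have := sf (rcons s i) y Dy.
by rewrite /partials foldr_rcons.
Qed.

Lemma is_derive_line f (e z : 'rV[R]_n) (s : R) : derivable f (z + s *: e) e ->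
  is_derive s 1 (fun s : R => f (z + s *: e)) ('D_e f (z + s *: e)).
Proof.
have E : (fun h : R => h^-1 *: (((fun s : R => f (z + s *: e)) \o shift s) (h *: 1) - f (z + s *: e)))
   = (fun h : R => h^-1 *: ((f \o shift (z + s *: e)) (h *: e) - f (z + s *: e))).
  apply/funext => h /=; congr (_ *: (f _ - _)).
  by rewrite scalerDl [h *: 1]mulr1 addrCA.
by move=> df; split; rewrite /derivable /derive E.
Qed.

Lemma mean_value_step f i z (t c eps : R) : 0 <= t ->
  (forall s, 0 <= s <= t -> derivable f (z + s *: delta_mx 0 i) (delta_mx 0 i) /\
     `|partial i f (z + s *: delta_mx 0 i) - c| <= eps) ->
  `|f (z + t *: delta_mx 0 i) - f z - t * c| <= t * eps.
Proof.
move=> t0 H.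
have Hd s : s \in `[0, t] -> is_derive s 1 (fun s : R => f (z + s *: delta_mx 0 i))
    (partial i f (z + s *: delta_mx 0 i)).
  by move=> st; apply: is_derive_line; apply: (H s _).1; rewrite in_itv in st.
have [|s st] := @MVT_segment _ (fun s : R => f (z + s *: delta_mx 0 i))
   (fun s => partial i f (z + s *: delta_mx 0 i)) 0 t t0 (fun s st => Hd s (subset_itv_oo_cc st)).
  by apply: derivable_within_continuous => s /Hd[].
rewrite scale0r addr0 subr0 => ->; rewrite [t * c]mulrC -mulrBl normrM mulrC.
rewrite (ger0_norm t0) ler_wpM2l//; apply: (H s _).2; by rewrite in_itv in st.
Qed.

Lemma mean_value_step_signed f i z (t c eps : R) :
  (forall s, `|s| <= `|t| -> derivable f (z + s *: delta_mx 0 i) (delta_mx 0 i) /\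
     `|partial i f (z + s *: delta_mx 0 i) - c| <= eps) ->
  `|f (z + t *: delta_mx 0 i) - f z - t * c| <= `|t| * eps.
Proof.
move=> H; have [t0|t0] := leP 0 t.
  rewrite [`|t|](ger0_norm t0); apply: mean_value_step => // s /andP[s0 st].
  by apply: H; rewrite !ger0_norm.
have Nt0 : 0 <= - t by rewrite oppr_ge0 ltW.
rewrite [`|t|](ltr0_norm t0).
(* For negative [t] the segment is traversed backwards, starting from its far end. *)
have := @mean_value_step f i (z + t *: delta_mx 0 i) (- t) c eps Nt0.
have -> : z + t *: delta_mx 0 i + - t *: delta_mx 0 i = z.
  by rewrite -addrA -scalerDl subrr scale0r addr0.
have -> : f z - f (z + t *: delta_mx 0 i) - - t * c =
    - (f (z + t *: delta_mx 0 i) - f z - t * c) by ring.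
rewrite normrN; apply => s /andP[s0 st].
rewrite -addrA -scalerDl; apply: H.
rewrite [`|t|](ltr0_norm t0) ler0_norm; lra.
Qed.

Definition grad f (y : 'rV[R]_n) : 'cV[R]_n := \col_i partial i f y.

Definition grad_form f (y h : 'rV[R]_n) : R := (h *m grad f y) 0 0.

Fact grad_form_is_linear f y : linear (grad_form f y).
Proof. by move=> a h k; rewrite /grad_form mulmxDl -scalemxAl !mxE. Qed.

HB.instance Definition _ f y := GRing.isLinear.Build _ _ _ _ (grad_form f y) (grad_form_is_linear f y).

Lemma grad_formE f y h : grad_form f y h = \sum_i h 0 i * partial i f y.
Proof. by rewrite /grad_form mxE; apply: eq_bigr => i _; rewrite mxE. Qed.

Lemma continuous_grad_form f y : continuous (grad_form f y).
Proof.
move=> h; rewrite (_ : grad_form f y = \sum_i (fun h : 'rV[R]_n => h 0 i * partial i f y)); last first.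
  by apply/funext => k; rewrite grad_formE fct_sumE.
elim/big_ind : _ => [|g k|i _]; [exact: cst_continuous|exact: continuousD|].
have c1 : {for h, continuous (fun h : 'rV[R]_n => h 0 i)} by exact: coord_continuous.
have c2 : {for h, continuous (fun _ : 'rV[R]_n => partial i f y)} by exact: cst_continuous.
exact: (continuousM c1 c2).
Qed.

Definition truncate_row k (h : 'rV[R]_n) : 'rV[R]_n := \row_j (if (j < k)%N then h 0 j else 0).

Lemma coord_le_norm (h : 'rV[R]_n) j : `|h 0 j| <= `|h|.
Proof.
rewrite [`|h|]mx_normrE; exact: (le_bigmax _ (fun ij : 'I_1 * 'I_n => `|h ij.1 ij.2|) (0, j)).
Qed.

Lemma norm_rV_le (h : 'rV[R]_n) (e : R) : 0 <= e -> (forall j, `|h 0 j| <= e) -> `|h| <= e.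
Proof.
move=> e0 he; rewrite [`|h|]mx_normrE; apply/bigmax_leP; split => // -[i j] _ /=.
by rewrite ord1.
Qed.

Lemma truncate_rowS k (h : 'rV[R]_n) (kn : (k < n)%N) :
  truncate_row k.+1 h = truncate_row k h + h 0 (Ordinal kn) *: delta_mx 0 (Ordinal kn).
Proof.
apply/rowP => j; rewrite !mxE eqxx /= ltnS leq_eqVlt -val_eqE /=.
case: (eqVneq (j : nat) k) => [jk|] /=.
  rewrite jk ltnn add0r mulr1; congr (h _ _); exact/val_inj.
by rewrite mulr0 addr0.
Qed.

Lemma truncate_row_id (h : 'rV[R]_n) : truncate_row n h = h.
Proof. by apply/rowP => j; rewrite mxE ltn_ord. Qed.

Lemma truncate_row0 (h : 'rV[R]_n) : truncate_row 0 h = 0.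
Proof. by apply/rowP => j; rewrite !mxE. Qed.

(** The increment [h] is switched on one coordinate at a time through [truncate_row]. Each step is
    parallel to an axis, where the mean value theorem bounds the error by [|h| * e], and there are
    [n] steps. The intermediate points stay within distance [d] of [y] because the norm is the
    maximum of the coordinates. *)
Lemma linear_approximation f y (d e : R) (h : 'rV[R]_n) :
  (forall z, `|z| <= d -> forall i, derivable f (y + z) (delta_mx 0 i) /\
     `|partial i f (y + z) - partial i f y| <= e) ->
  0 <= e -> `|h| <= d -> `|f (y + h) - f y - grad_form f y h| <= n%:R * `|h| * e.
Proof.
move=> H e0 hd.
suff: forall k, (k <= n)%N -> `|f (y + truncate_row k h) - f y - grad_form f y (truncate_row k h)|
    <= k%:R * `|h| * e.
  by move=> /(_ n (leqnn n)); rewrite truncate_row_id.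
elim=> [_|k ih kn].
  by rewrite truncate_row0 addr0 linear0 subrr subr0 normr0 !mul0r.
rewrite (truncate_rowS _ kn); pose t : R := h 0 (Ordinal kn); rewrite -/t; set i := Ordinal kn; set z := truncate_row k h.
rewrite linearD linearZ /= [grad_form f y (delta_mx 0 i)](_ : _ = partial i f y); last first.
  by rewrite grad_formE (bigD1 i)//= mxE !eqxx mul1r big1 ?addr0// => j ji;
     rewrite mxE (negbTE ji) mul0r.
have -> : f (y + (z + t *: delta_mx 0 i)) - f y - (grad_form f y z + t *: partial i f y)
  = (f (y + z + t *: delta_mx 0 i) - f (y + z) - t * partial i f y)
    + (f (y + z) - f y - grad_form f y z).
  rewrite (addrA y z); move: (f (y + z + _)) (f (y + z)) (f y) (grad_form _ _ _) (partial _ _ _).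
  move=> a1 a2 a3 a4 a5; have -> : t *: a5 = t * a5 by [].
  by move: t => t; ring.
rewrite -natr1 mulrDl mul1r mulrDl; apply: (le_trans (ler_normD _ _)); rewrite [leLHS]addrC.
apply: lerD; first exact: ih (ltnW kn).
have te : `|t| * e <= `|h| * e by exact: (ler_wpM2r e0 (coord_le_norm h _)).
apply: (le_trans _ te).
apply: mean_value_step_signed => s st; rewrite -addrA; apply: H.
apply: norm_rV_le; first exact: le_trans hd.
move=> j; apply: le_trans hd; rewrite !mxE eqxx /=.
case: (eqVneq j i) => [->|ji].
  by rewrite ltnn add0r mulr1 (le_trans st)// coord_le_norm.
by rewrite mulr0 addr0; case: ifP; rewrite ?normr0 ?coord_le_norm.
Qed.

(** Smoothness speaks of partial derivatives only, while the chain rule for transition maps needs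
    total differentiability; continuity of the partial derivatives bridges the gap. *)
Lemma C1_differentiable D f y : open D -> C1_on D f -> D y -> differentiable f y.
Proof.
move=> oD C1f Dy.
have expand : f \o shift y = cst (f y) + grad_form f y +o_ (0 : 'rV[R]_n) id.
  apply/eqaddoP => e e0.
  (* The linear approximation loses a factor [n]; dividing by [n.+1] absorbs it and is also
     legitimate in dimension 0. *)
  pose e' := e / n.+1%:R.
  have e'0 : 0 < e' by rewrite divr_gt0.
  have : \forall z \near y, D z /\ forall i, `|partial i f z - partial i f y| <= e'.
    apply: filterI; first exact: open_nbhs_nbhs.
    apply: (@filter_forall _ _ (fun i z => `|partial i f z - partial i f y| <= e') (nbhs y)) => i.
    have := ((C1f _ Dy).2 i).2; by move/cvgr_distC_le => /(_ _ e'0).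
  move=> /nbhs_ballP[d /= d0 dH].
  near=> h; have -> : (f \o shift y - (cst (f y) + grad_form f y)) h =
      f (h + y) - (f y + grad_form f y h) by [].
  rewrite (addrC h y) opprD addrA.
  apply: (le_trans (@linear_approximation f y (d / 2) e' h _ _ _)).
  - move=> z zd i; have [|Dz Hz] := dH (y + z).
      by rewrite -ball_normE /= opprD addNKr normrN (le_lt_trans zd)//; lra.
    by split; [exact: ((C1f _ Dz).2 i).1|exact: Hz].
  - exact: ltW.
  - near: h; apply/nbhs_ballP; exists (d / 2) => /=; first by rewrite divr_gt0.
    by move=> h; rewrite -ball_normE /= sub0r normrN => /ltW.
  - by rewrite mulrAC ler_wpM2r// /e' mulrCA ger_pMr// ler_pdivrMr// mul1r ler_nat leqnSn.
have dE := @diff_unique _ _ _ f (grad_form f y) y (@continuous_grad_form f y) expand.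
by apply/diff_locallyP; rewrite dE; split => //; exact: continuous_grad_form.
Unshelve. all: by end_near. Qed.

Lemma differentiable_rV m (t : 'rV[R]_n -> 'rV[R]_m) y :
  (forall k, differentiable (fun z => t z 0 k) y) -> differentiable t y.
Proof.
move=> dt; have -> : t = \sum_k (fun z => t z 0 k *: delta_mx 0 k).
  by apply/funext => z; rewrite fct_sumE {1}[t z]row_sum_delta.
by apply: differentiable_sum => k; exact: differentiableZl.
Qed.
End C1.

(** The Jacobian acts on row vectors from the right, so the derivative of [t] along the [i]-th axis
    is the [i]-th row of ['J t y]. *)
Lemma partial_comp n m D E (t : 'rV[R]_n -> 'rV[R]_m) (f : 'rV[R]_m -> R) i y :
  open D -> open E -> (forall k, C1_on D (fun z => t z 0 k)) -> C1_on E f ->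
  D y -> E (t y) ->
  partial i (f \o t) y = \sum_j ('J t y) i j * partial j f (t y).
Proof.
move=> oD oE C1t C1f Dy Ety.
have dt : differentiable t y.
  by apply: differentiable_rV => k; exact: (C1_differentiable oD).
have df : differentiable f (t y) by exact: (C1_differentiable oE).
rewrite /partial deriveE; last exact: differentiable_comp.
rewrite diff_comp//= -(deriveE _ dt) deriveEjacobian//.
rewrite -rowE {1}[row i _]row_sum_delta linear_sum; apply: eq_bigr => j _.
by rewrite linearZ /= -(deriveE _ df) mxE.
Qed.

(** * Continuity of the curvature in coordinates *)

Section Curvature.
Context {n : nat}.
Variables (D : set 'rV[R]_n) (g : 'rV[R]_n -> 'M[R]_n).
Hypotheses (oD : open D) (sg : forall i j, smooth_on D (fun y => g y i j)).
Hypothesis ug : forall y, D y -> g y \in unitmx.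

Lemma C1_inv_metric i j : C1_on D (fun y => invmx (g y) i j).
Proof. by apply: C1_invmx => // k l; exact: smooth_C1. Qed.

Lemma C1_christoffel k i j : C1_on D (christoffel g k i j).
Proof.
have C1p a b c : C1_on D (partial a (fun z => g z b c)).
  by apply: smooth_C1; exact: smooth_partial.
apply: (C1_mul oD); first exact: C1_cst.
apply: (C1_sum _ _ oD) => l; apply: (C1_mul oD); first exact: C1_inv_metric.
apply: (C1_add oD); first exact: (C1_add oD).
rewrite (_ : (fun y => _) = (fun y => -1 * partial l (fun z : 'rV[R]_n => g z i j) y)).
  by apply: (C1_mul oD) => //; exact: C1_cst.
by apply/funext => y; rewrite mulN1r.
Qed.

Lemma continuous_at_sum (T : topologicalType) (I : Type) (r : seq I) (F : I -> T -> R) (x : T) :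
  (forall i, {for x, continuous (F i)}) -> {for x, continuous (fun z => \sum_(i <- r) F i z)}.
Proof.
move=> cF; elim: r => [|j r ih].
  rewrite (_ : (fun z => _) = cst 0); first exact: cst_continuous.
  by apply/funext => z; rewrite big_nil.
rewrite (_ : (fun z => _) = (fun z => F j z + \sum_(i <- r) F i z)).
  exact: (continuousD (cF j) ih).
by apply/funext => z; rewrite big_cons.
Qed.

Lemma continuous_coord_scalar_curvature y : D y ->
  {for y, continuous (coord_scalar_curvature g)}.
Proof.
move=> Dy.
have cI i j : {for y, continuous (fun y => invmx (g y) i j)} by have [] := @C1_inv_metric i j _ Dy.
have cG i j k : {for y, continuous (christoffel g i j k)} by have [] := @C1_christoffel i j k _ Dy.
have cP l i j k : {for y, continuous (partial l (christoffel g i j k))}.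
  by have [_ /(_ l)[]] := @C1_christoffel i j k _ Dy.
apply: continuous_at_sum => i; apply: continuous_at_sum => j.
apply: (continuousM (cI i j)); apply: continuousD; apply: continuous_at_sum => k.
  exact: (continuousB (cP _ _ _ _) (cP _ _ _ _)).
apply: continuous_at_sum => l.
by apply: continuousB; apply: continuousM.
Qed.

End Curvature.
End Calculus.

(** * Block diagonal metrics *)

Section BlockMetric.
Context {R : realType} {v w : nat}.

Lemma partial_lshift (i : 'I_v) (F : 'rV[R]_(v + w) -> R) z :
  partial (lshift w i) F z = partial i (fun a => F (row_mx a (rsubmx z))) (lsubmx z).
Proof.
rewrite /partial /derive.
pose f (a : 'rV[R]_v) := F (row_mx a (rsubmx z)).
suff -> : (fun h : R => h^-1 *: ((F \o shift z) (h *: delta_mx 0 (lshift w i)) - F z)) =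
   (fun h : R => h^-1 *: ((f \o shift (lsubmx z)) (h *: delta_mx 0 i) - f (lsubmx z))) by [].
apply/funext => h /=; rewrite /f hsubmxK; congr (_ *: (F _ - _)).
rewrite -[z in LHS]hsubmxK (_ : delta_mx 0 (lshift w i) = row_mx (delta_mx 0 i) 0).
  by rewrite scale_row_mx add_row_mx scaler0 add0r.
apply/rowP => k; rewrite !mxE; case: splitP => j kj; rewrite !mxE eqxx /= -val_eqE /= kj //=.
by rewrite gtn_eqF// ltn_addr.
Qed.

Lemma partial_rshift (i : 'I_w) (F : 'rV[R]_(v + w) -> R) z :
  partial (rshift v i) F z = partial i (fun b => F (row_mx (lsubmx z) b)) (rsubmx z).
Proof.
rewrite /partial /derive.
pose f (a : 'rV[R]_w) := F (row_mx (lsubmx z) a).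
suff -> : (fun h : R => h^-1 *: ((F \o shift z) (h *: delta_mx 0 (rshift v i)) - F z)) =
   (fun h : R => h^-1 *: ((f \o shift (rsubmx z)) (h *: delta_mx 0 i) - f (rsubmx z))) by [].
apply/funext => h /=; rewrite /f hsubmxK; congr (_ *: (F _ - _)).
rewrite -[z in LHS]hsubmxK (_ : delta_mx 0 (rshift v i) = row_mx 0 (delta_mx 0 i)).
  by rewrite scale_row_mx add_row_mx scaler0 add0r.
apply/rowP => k; rewrite !mxE; case: splitP => j kj; rewrite !mxE eqxx /= -val_eqE /= kj //=.
  by rewrite ltn_eqF// ltn_addr.
by rewrite eqn_add2l.
Qed.

Lemma partial_cst n (i : 'I_n) (a : R) z : partial i (cst a) z = 0.
Proof. exact: derive_cst. Qed.

Lemma partial_lshift_lsubmx (i : 'I_v) (f : 'rV[R]_v -> R) z :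
  partial (lshift w i) (f \o lsubmx) z = partial i f (lsubmx z).
Proof. by rewrite partial_lshift; congr partial; apply/funext => a /=; rewrite row_mxKl. Qed.

Lemma partial_rshift_lsubmx (i : 'I_w) (f : 'rV[R]_v -> R) z :
  partial (rshift v i) (f \o lsubmx) z = 0.
Proof.
rewrite partial_rshift -(@partial_cst _ i (f (lsubmx z)) (rsubmx z)).
by congr partial; apply/funext => a /=; rewrite row_mxKl.
Qed.

Lemma partial_rshift_rsubmx (i : 'I_w) (f : 'rV[R]_w -> R) z :
  partial (rshift v i) (f \o rsubmx) z = partial i f (rsubmx z).
Proof. by rewrite partial_rshift; congr partial; apply/funext => a /=; rewrite row_mxKr. Qed.

Lemma partial_lshift_rsubmx (i : 'I_v) (f : 'rV[R]_w -> R) z :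
  partial (lshift w i) (f \o rsubmx) z = 0.
Proof.
rewrite partial_lshift -(@partial_cst _ i (f (rsubmx z)) (lsubmx z)).
by congr partial; apply/funext => a /=; rewrite row_mxKr.
Qed.

Definition partial_submxE := (partial_lshift_lsubmx, partial_rshift_lsubmx,
  partial_rshift_rsubmx, partial_lshift_rsubmx).

(** Checked by multiplying out, after the determinant of the block matrix shows it invertible. *)
Lemma invmx_block_diag m n (A : 'M[R]_m) (B : 'M[R]_n) :
  A \in unitmx -> B \in unitmx ->
  invmx (block_mx A 0 0 B) = block_mx (invmx A) 0 0 (invmx B).
Proof.
move=> uA uB; have uAB : block_mx A 0 0 B \in unitmx.
  by rewrite unitmxE det_ublock unitrM -!unitmxE uA.
apply: (can_inj (mulKmx uAB)); rewrite mulmxV// mulmx_block.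
by rewrite !(mul0mx, mulmx0, addr0, add0r) !mulmxV// -scalar_mx_block.
Qed.

Variables (g : 'rV[R]_v -> 'M[R]_v) (h : 'rV[R]_w -> 'M[R]_w).
Variables (D : set 'rV[R]_v) (E : set 'rV[R]_w).
Hypotheses (oD : open D) (oE : open E).
Hypotheses (ug : forall y, D y -> g y \in unitmx) (uh : forall y, E y -> h y \in unitmx).

Let G z : 'M[R]_(v + w) := block_mx (g (lsubmx z)) 0 0 (h (rsubmx z)).
Let DE : set 'rV[R]_(v + w) := [set z | D (lsubmx z) /\ E (rsubmx z)].

Let oDE : open DE.
Proof.
have -> : DE = (lsubmx @^-1` D) `&` (rsubmx @^-1` E) by [].
apply: openI; apply: open_comp => // z _; [exact: continuous_lsubmx|exact: continuous_rsubmx].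
Qed.

Let invG z : DE z -> invmx (G z) = block_mx (invmx (g (lsubmx z))) 0 0 (invmx (h (rsubmx z))).
Proof. by case=> Dz Ez; apply: invmx_block_diag; [exact: ug|exact: uh]. Qed.

Let Gll a b : (fun z => G z (lshift w a) (lshift w b)) = (fun y => g y a b) \o lsubmx.
Proof. by apply/funext => z /=; rewrite block_mxEul. Qed.
Let Glr a b : (fun z => G z (lshift w a) (rshift v b)) = cst 0.
Proof. by apply/funext => z /=; rewrite block_mxEur mxE. Qed.
Let Grl a b : (fun z => G z (rshift v a) (lshift w b)) = cst 0.
Proof. by apply/funext => z /=; rewrite block_mxEdl mxE. Qed.
Let Grr a b : (fun z => G z (rshift v a) (rshift v b)) = (fun y => h y a b) \o rsubmx.
Proof. by apply/funext => z /=; rewrite block_mxEdr. Qed.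
Let pG := (Gll, Glr, Grl, Grr, partial_submxE, partial_cst).
Let iG := (block_mxEul, block_mxEur, block_mxEdl, block_mxEdr).

Let sum_left (F : 'I_(v + w) -> R) (F' : 'I_v -> R) :
  (forall l, F (lshift w l) = F' l) -> (forall l, F (rshift v l) = 0) ->
  \sum_l F l = \sum_l F' l.
Proof.
by move=> Fl Fr; rewrite big_split_ord /= [X in _ + X]big1// addr0; apply: eq_bigr.
Qed.
Let sum_right (F : 'I_(v + w) -> R) (F' : 'I_w -> R) :
  (forall l, F (lshift w l) = 0) -> (forall l, F (rshift v l) = F' l) ->
  \sum_l F l = \sum_l F' l.
Proof.
by move=> Fl Fr; rewrite big_split_ord /= [X in X + _]big1// add0r; apply: eq_bigr.
Qed.
Let sum_zero (F : 'I_(v + w) -> R) :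
  (forall l, F (lshift w l) = 0) -> (forall l, F (rshift v l) = 0) ->
  \sum_l F l = 0.
Proof. by move=> Fl Fr; rewrite big_split_ord /= !big1 ?addr0. Qed.

Let zE := (addr0, add0r, subr0, oppr0, mulr0, mul0r).

Local Ltac chr0 Dz := rewrite /christoffel sum_zero ?mulr0 // => l;
  rewrite (invG Dz) iG !pG ?mxE ?zE //.

(** This and the next seven facts list the Christoffel symbols by block. Each term of the defining
    sum contains an entry of the inverse metric times derivatives of metric entries. For mixed
    indices, either the inverse entry is off-diagonal, or every derivative is that of a zero entry
    or of a block with respect to the variables of the other factor; so only the two pure families
    survive. *)
Let chr_lll z k i j : DE z ->
  christoffel G (lshift w k) (lshift w i) (lshift w j) z = christoffel g k i j (lsubmx z).
Proof.
by move=> Dz; congr (_ * _); apply: sum_left => l; rewrite (invG Dz) iG !pG // ?mxE ?zE.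
Qed.
Let chr_rrr z k i j : DE z ->
  christoffel G (rshift v k) (rshift v i) (rshift v j) z = christoffel h k i j (rsubmx z).
Proof.
by move=> Dz; congr (_ * _); apply: sum_right => l; rewrite (invG Dz) iG !pG // ?mxE ?zE.
Qed.
Let chr_llr z k i j : DE z -> christoffel G (lshift w k) (lshift w i) (rshift v j) z = 0.
Proof. by move=> Dz; chr0 Dz. Qed.
Let chr_lrl z k i j : DE z -> christoffel G (lshift w k) (rshift v i) (lshift w j) z = 0.
Proof. by move=> Dz; chr0 Dz. Qed.
Let chr_lrr z k i j : DE z -> christoffel G (lshift w k) (rshift v i) (rshift v j) z = 0.
Proof. by move=> Dz; chr0 Dz. Qed.
Let chr_rll z k i j : DE z -> christoffel G (rshift v k) (lshift w i) (lshift w j) z = 0.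
Proof. by move=> Dz; chr0 Dz. Qed.
Let chr_rlr z k i j : DE z -> christoffel G (rshift v k) (lshift w i) (rshift v j) z = 0.
Proof. by move=> Dz; chr0 Dz. Qed.
Let chr_rrl z k i j : DE z -> christoffel G (rshift v k) (rshift v i) (lshift w j) z = 0.
Proof. by move=> Dz; chr0 Dz. Qed.

(** The block formulas for the Christoffel symbols hold only on [DE], where the metric is known to
    be invertible; since [DE] is open they may still be differentiated there. *)
Let partial_DE (c : 'I_(v + w)) f f' z : DE z -> (forall z, DE z -> f z = f' z) ->
  partial c f z = partial c f' z.
Proof.
move=> Dz ff'; apply: near_partial; have := open_nbhs_nbhs (conj oDE Dz).
by apply: filterS => x /ff'.
Qed.

Let pchr_lll z c k i j : DE z ->
  partial (lshift w c) (christoffel G (lshift w k) (lshift w i) (lshift w j)) z =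
  partial c (christoffel g k i j) (lsubmx z).
Proof.
move=> Dz; rewrite -partial_lshift_lsubmx; apply: (partial_DE _ Dz) => x Dx /=.
exact: chr_lll.
Qed.
Let pchr_rrr z c k i j : DE z ->
  partial (rshift v c) (christoffel G (rshift v k) (rshift v i) (rshift v j)) z =
  partial c (christoffel h k i j) (rsubmx z).
Proof.
move=> Dz; rewrite -partial_rshift_rsubmx; apply: (partial_DE _ Dz) => x Dx /=.
exact: chr_rrr.
Qed.
Let pchr0 z c k i j : DE z -> (forall z, DE z -> christoffel G k i j z = 0) ->
  partial c (christoffel G k i j) z = 0.
Proof.
by move=> Dz H; rewrite -(@partial_cst _ c 0 z); exact: (partial_DE _ Dz).
Qed.
Let pchr_lrl z c k i j (Dz : DE z) := @pchr0 z c _ _ _ Dz (fun z => @chr_lrl z k i j).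
Let pchr_lrr z c k i j (Dz : DE z) := @pchr0 z c _ _ _ Dz (fun z => @chr_lrr z k i j).
Let pchr_rll z c k i j (Dz : DE z) := @pchr0 z c _ _ _ Dz (fun z => @chr_rll z k i j).
Let pchr_rlr z c k i j (Dz : DE z) := @pchr0 z c _ _ _ Dz (fun z => @chr_rlr z k i j).

Let ricci_ll z i j : DE z ->
  ricci G (lshift w i) (lshift w j) z = ricci g i j (lsubmx z).
Proof.
move=> Dz; congr (_ + _); apply: sum_left => k.
- by rewrite !pchr_lll.
- by rewrite pchr_rll// pchr_rlr// subr0.
- by apply: sum_left => l; rewrite ?chr_lll ?chr_rll ?chr_llr ?chr_lrl ?zE.
- apply: sum_zero => l.
  + by rewrite (chr_rrl _ _ _ Dz) (chr_rll _ _ _ Dz) !zE.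
  + by rewrite (chr_rll _ _ _ Dz) (chr_rlr _ _ _ Dz) !zE.
Qed.
Let ricci_rr z i j : DE z ->
  ricci G (rshift v i) (rshift v j) z = ricci h i j (rsubmx z).
Proof.
move=> Dz; congr (_ + _); apply: sum_right => k.
- by rewrite pchr_lrr// pchr_lrl// subr0.
- by rewrite !pchr_rrr.
- apply: sum_zero => l.
  + by rewrite (chr_lrr _ _ _ Dz) (chr_lrl _ _ _ Dz) !zE.
  + by rewrite (chr_llr _ _ _ Dz) (chr_lrr _ _ _ Dz) !zE.
- by apply: sum_right => l; rewrite ?chr_rrr ?chr_lrr ?chr_rrl ?chr_rlr ?zE.
Qed.

(** Only the two diagonal blocks of the Ricci matrix contribute to the trace: the mixed ones are
    multiplied by the vanishing off-diagonal blocks of the inverse metric. *)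
Lemma coord_scalar_curvature_block z : D (lsubmx z) -> E (rsubmx z) ->
  coord_scalar_curvature (fun z => block_mx (g (lsubmx z)) 0 0 (h (rsubmx z))) z =
  coord_scalar_curvature g (lsubmx z) + coord_scalar_curvature h (rsubmx z).
Proof.
move=> Dz Ez; have DEz : DE z by [].
rewrite /coord_scalar_curvature big_split_ord /=; congr (_ + _); apply: eq_bigr => i _.
  apply: sum_left => j; first by rewrite -(ricci_ll _ _ DEz) (invG DEz) iG.
  by rewrite (invG DEz) iG mxE mul0r.
apply: sum_right => j; last by rewrite -(ricci_rr _ _ DEz) (invG DEz) iG.
by rewrite (invG DEz) iG mxE mul0r.
Qed.

Lemma coord_sqnorm_block (F : 'rV[R]_(v + w) -> R) z : D (lsubmx z) -> E (rsubmx z) ->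
  \sum_k \sum_l invmx (block_mx (g (lsubmx z)) 0 0 (h (rsubmx z))) k l *
    partial k F z * partial l F z =
  \sum_k \sum_l invmx (g (lsubmx z)) k l *
    partial k (fun a => F (row_mx a (rsubmx z))) (lsubmx z) *
    partial l (fun a => F (row_mx a (rsubmx z))) (lsubmx z) +
  \sum_k \sum_l invmx (h (rsubmx z)) k l *
    partial k (fun b => F (row_mx (lsubmx z) b)) (rsubmx z) *
    partial l (fun b => F (row_mx (lsubmx z) b)) (rsubmx z).
Proof.
move=> Dz Ez; have DEz : DE z by [].
rewrite big_split_ord /=; congr (_ + _); apply: eq_bigr => i _.
  by apply: sum_left => j; rewrite (invG DEz) iG ?mxE ?mul0r// !partial_lshift.
by apply: sum_right => j; rewrite (invG DEz) iG ?mxE ?mul0r// !partial_rshift.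
Qed.

End BlockMetric.

(** * Functions on manifolds and products *)

Lemma continuous_at_mx (R : realType) (T : topologicalType) m n (f : T -> 'M[R]_(m, n)) x :
  (forall i j, {for x, continuous (fun z => f z i j)}) -> {for x, continuous f}.
Proof.
move=> cf A [P HP PA].
suff : nbhs x [set z | forall i j, P i j (f z i j)].
  by apply: filterS => z Hz; exact: PA.
apply: (@filter_forall _ _ (fun i z => forall j, P i j (f z i j)) (nbhs x)) => i.
apply: (@filter_forall _ _ (fun j z => P i j (f z i j)) (nbhs x)) => j.
exact: (cf i j _ (HP i j)).
Qed.

Lemma continuous_at_row_mx (R : realType) (T : topologicalType) m n
    (f : T -> 'rV[R]_m) (g : T -> 'rV[R]_n) x :
  {for x, continuous f} -> {for x, continuous g} ->
  {for x, continuous (fun z => row_mx (f z) (g z))}.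
Proof.
move=> cf cg; apply: continuous_at_mx => i j; rewrite ord1.
case: (split_ordP j) => k ->.
  rewrite (_ : (fun z => _) = (fun y : 'rV[R]_m => y 0 k) \o f); last first.
    by apply/funext => z /=; rewrite row_mxEl.
  by apply: continuous_comp => //; exact: coord_continuous.
rewrite (_ : (fun z => _) = (fun y : 'rV[R]_n => y 0 k) \o g); last first.
  by apply/funext => z /=; rewrite row_mxEr.
by apply: continuous_comp => //; exact: coord_continuous.
Qed.

Lemma continuous_at_prod (R : realType) (T : topologicalType) (I : Type) (r : seq I)
    (F : I -> T -> R) (x : T) :
  (forall i, {for x, continuous (F i)}) -> {for x, continuous (fun z => \prod_(i <- r) F i z)}.
Proof.
move=> cF; elim: r => [|j r ih].
  rewrite (_ : (fun z => _) = cst 1); first exact: cst_continuous.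
  by apply/funext => z; rewrite big_nil.
rewrite (_ : (fun z => _) = (fun z => F j z * \prod_(i <- r) F i z)).
  exact: (continuousM (cF j) ih).
by apply/funext => z; rewrite big_cons.
Qed.

Lemma continuous_at_det (R : realType) (T : topologicalType) m (A : T -> 'M[R]_m) x :
  (forall i j, {for x, continuous (fun z => A z i j)}) ->
  {for x, continuous (fun z => \det (A z))}.
Proof.
move=> cA; apply: continuous_at_sum => s.
have c1 : {for x, continuous (fun _ : T => (-1) ^+ perm.odd_perm s : R)} by exact: cst_continuous.
apply: (continuousM c1); exact: continuous_at_prod.
Qed.

(** * Positive definite matrices *)

Definition posdefmx (R : realType) n (A : 'M[R]_n) :=
  forall xi : 'rV[R]_n, xi != 0 -> 0 < (xi *m A *m xi^T) 0 0.

Lemma posdefmx_unit (R : realType) n (A : 'M[R]_n) : posdefmx A -> A \in unitmx.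
Proof.
move=> pA; rewrite -row_free_unit; apply: inj_row_free => xi xiA0.
apply/eqP/negPn/negP => /pA; by rewrite xiA0 mul0mx mxE ltxx.
Qed.

(** The segment from the identity to [A] consists of positive definite, hence invertible, matrices.
    The determinant is continuous on it, equals 1 at the start and never vanishes, so by the
    intermediate value theorem it stays positive. *)
Lemma posdefmx_det_gt0 (R : realType) n (A : 'M[R]_n) : posdefmx A -> 0 < \det A.
Proof.
move=> pA; pose M (t : R) := (1 - t)%:M + t *: A.
have pM t : 0 <= t <= 1 -> posdefmx (M t).
  move=> /andP[t0 t1] xi xi0; rewrite /M mulmxDr mulmxDl mxE.
  rewrite mul_mx_scalar -!scalemxAr -!scalemxAl [X in X + _]mxE [X in _ + X]mxE.
  have sq : 0 < (xi *m xi^T) 0 0.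
    have [j xij] : exists j, xi 0 j != 0.
      apply/existsP; apply: contraNT xi0; rewrite negb_exists => /forallP xi0.
      by apply/eqP/rowP => j; rewrite mxE; apply/eqP; rewrite -[_ == _]negbK.
    rewrite mxE (bigD1 j)//= ltr_pwDl//.
      by rewrite mxE -expr2 exprn_even_gt0.
    by apply: sumr_ge0 => k _; rewrite mxE -expr2 sqr_ge0.
  have [->|t0'] := eqVneq t 0; first by rewrite subr0 mul1r mul0r addr0.
  apply: ltr_wpDl; first by apply: mulr_ge0; [rewrite subr_ge0|exact: ltW].
  by apply: mulr_gt0; [rewrite lt_neqAle eq_sym t0' t0|exact: pA].
have cM : {within `[0, 1], continuous (fun t => \det (M t))}.
  apply: continuous_subspaceT => t; apply: continuous_at_det => i j.
  rewrite (_ : (fun z => _) = (fun z => (1 - z) *+ (i == j) + z * A i j)).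
    apply: continuousD.
      case: (i == j) => /=; last exact: cst_continuous.
      by apply: continuousB => //; exact: cst_continuous.
    by apply: continuousM => //; exact: cst_continuous.
  by apply/funext => z; rewrite !mxE.
have M0 : \det (M 0) = 1 by rewrite /M subr0 scale0r addr0 det1.
have M1 : \det (M 1) = \det A by rewrite /M subrr scale1r raddf0 add0r.
rewrite ltNge; apply/negP => dA.
have [|c] := IVT ler01 cM (v := 0).
  by rewrite M0 M1 ge_min dA orbT le_max ler01.
rewrite in_itv /= => /pM/posdefmx_unit; rewrite unitmxE unitfE => /eqP c0 /c0.
by [].
Qed.

(** * Chart independence and continuity on a single manifold *)

Section Manifold.
Context {R : realType} {n : nat}.
Variable N : riemannian_data R n.
Hypothesis hN : is_riemannian_manifold N.
Implicit Types (i j : chart_index N) (x : N) (y : 'rV[R]_n).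

Lemma is_chartP i : is_chart i.
Proof. by case: hN => -[]. Qed.

Lemma open_dom i : open (dom i).
Proof. by case: (is_chartP i). Qed.

Lemma open_image i : open (chart i @` dom i).
Proof. by case: (is_chartP i). Qed.

Lemma paramK i x : dom i x -> param i (chart i x) = x.
Proof. by case: (is_chartP i) => _ _ + _ _; apply. Qed.

Lemma chart_continuous i x : dom i x -> {for x, continuous (chart i)}.
Proof. by case: (is_chartP i) => _ _ _ + _; apply. Qed.

Lemma param_continuous i y : (chart i @` dom i) y -> {for y, continuous (param i)}.
Proof. by case: (is_chartP i) => _ _ _ _; apply. Qed.

Lemma dom_chart x : exists i, dom i x.
Proof.
case: hN => -[_ _ + _ _] _ => cov.
by have : setT x by []; rewrite -cov => -[i _ xi]; exists i.
Qed.

Lemma smooth_metric i k l : smooth_on (chart i @` dom i) (fun y => metric i y k l).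
Proof. by case: hN => _ []. Qed.

Lemma posdef_metric i y : (chart i @` dom i) y -> posdefmx (metric i y).
Proof. by case: hN => _ [_ _ + _]; apply. Qed.

Lemma unit_metric i y : (chart i @` dom i) y -> metric i y \in unitmx.
Proof. by move/posdef_metric/posdefmx_unit. Qed.

Lemma nbhs_dom i x : dom i x -> nbhs x (dom i).
Proof. by move=> xi; apply: open_nbhs_nbhs; split => //; exact: open_dom. Qed.

Lemma continuous_in_chart (f : N -> R) (F : 'rV[R]_n -> R) i x :
  dom i x -> (forall z, dom i z -> f z = F (chart i z)) ->
  {for chart i x, continuous F} -> {for x, continuous f}.
Proof.
move=> xi fF cF; apply: (@near_eq_continuous_at _ _ (F \o chart i)).
  by have := nbhs_dom xi; apply: filterS => z /fF.
by apply: continuous_comp => //; exact: chart_continuous.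
Qed.

Lemma smooth_function_continuous (u : N -> R) : smooth_function u -> continuous u.
Proof.
move=> su x; have [i xi] := dom_chart x.
apply: (@continuous_in_chart _ (u \o param i) i) => //.
  by move=> z zi /=; rewrite paramK.
have xD : (chart i @` dom i) (chart i x) by exists x.
exact: (su i [::] _ xD).1.
Qed.

Lemma continuous_scalar_curvature (s : N -> R) : is_scalar_curvature s -> continuous s.
Proof.
move=> hs x; have [i xi] := dom_chart x.
apply: (@continuous_in_chart _ (coord_scalar_curvature (metric i)) i) => //.
  by move=> z; exact: hs.
have xD : (chart i @` dom i) (chart i x) by exists x.
exact: (@continuous_coord_scalar_curvature _ _ _ (metric i) (@open_image i)
  (@smooth_metric i) (@unit_metric i) _ xD).
Qed.

(** This is the domain of a transition map, which must be open for identities on it to be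
    differentiated. *)
Lemma open_overlap i j : open (chart i @` (dom i `&` dom j)).
Proof.
rewrite openE => y [x [xi xj] <-].
have xD : (chart i @` dom i) (chart i x) by exists x.
have near1 := open_nbhs_nbhs (conj (@open_image i) xD).
have near2 : nbhs (chart i x) (param i @^-1` dom j).
  by apply: (param_continuous xD); rewrite paramK//; exact: nbhs_dom.
apply: filterS (filterI near1 near2) => z [[x' x'i <-]] /=.
by rewrite paramK// => x'j; exists x'.
Qed.

Lemma coord_sqnorm_dE (u : N -> R) i y : coord_sqnorm_d u i y =
  ((grad (u \o param i) y)^T *m invmx (metric i y) *m grad (u \o param i) y) 0 0.
Proof.
rewrite /coord_sqnorm_d mxE exchange_big; apply: eq_bigr => l _.
rewrite [X in _ = X * _]mxE big_distrl /=; apply: eq_bigr => k _; rewrite !mxE; ring.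
Qed.

(** With [J] the Jacobian of the transition map, the gradient column is multiplied by [J] and the
    metric becomes [J g J^T]; in the quadratic form of the inverse metric the factors [J] cancel. *)
Lemma coord_sqnorm_d_indep (u : N -> R) i j x : smooth_function u ->
  dom i x -> dom j x ->
  coord_sqnorm_d u i (chart i x) = coord_sqnorm_d u j (chart j x).
Proof.
move=> su xi xj; set y := chart i x.
have yD : (chart i @` (dom i `&` dom j)) y by exists x.
have xE : (chart j @` dom j) (chart j x) by exists x.
have tyE : transition i j y = chart j x by rewrite /transition /= paramK.
set J := 'J (transition i j) y.
have gE : metric i y = J *m metric j (chart j x) *m J^T.
  by rewrite -tyE; case: hN => _ [_ _ _]; apply.
have yDi : (chart i @` dom i) y by exists x.
(* Invertibility of the Jacobian is read off from that of the metric, which is a product having [J]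
   as a factor. *)
have := unit_metric yDi; rewrite gE !unitmx_mul => /andP[/andP[uJ ug] uJT].
have pE : grad (u \o param i) y = J *m grad (u \o param j) (chart j x).
  apply/colP => k; rewrite !mxE.
  have -> : partial k (u \o param i) y = partial k ((u \o param j) \o transition i j) y.
    apply: near_partial; have := open_nbhs_nbhs (conj (@open_overlap i j) yD).
    apply: filterS => z [x' [x'i x'j] <-] /=.
    by rewrite /transition /= !paramK.
  rewrite (@partial_comp _ _ _ (chart i @` (dom i `&` dom j)) (chart j @` dom j)) ?tyE//.
  - by apply: eq_bigr => l _; rewrite !mxE.
  - exact: open_overlap.
  - exact: open_image.
  - by move=> l; apply: smooth_C1; case: hN => -[_ _ _ _ +] _; apply.
  - by apply: smooth_C1; exact: su.
rewrite !coord_sqnorm_dE pE gE; congr (fun_of_matrix _ 0 0).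
have -> : invmx (J *m metric j (chart j x) *m J^T) =
    invmx J^T *m invmx (metric j (chart j x)) *m invmx J.
  have uM : J *m metric j (chart j x) *m J^T \in unitmx by rewrite !unitmx_mul uJ ug.
  apply: (can_inj (mulKmx uM)); rewrite mulmxV//.
  by rewrite !mulmxA (mulmxK uJT) (mulmxK ug) mulmxV.
rewrite trmx_mul !mulmxA (mulmxK uJT) -!mulmxA (mulmxA (invmx J)) mulVmx// mul1mx.
by rewrite !mulmxA.
Qed.

Lemma sqnorm_dE (u : N -> R) i x : smooth_function u -> dom i x ->
  sqnorm_d u x = coord_sqnorm_d u i (chart i x).
Proof.
move=> su xi; rewrite /sqnorm_d; case: xgetP => [r _ [j xj ->]|].
  exact: coord_sqnorm_d_indep.
by move=> /(_ (coord_sqnorm_d u i (chart i x)))[]; exists i.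
Qed.

Lemma continuous_inv_metric i k l y : (chart i @` dom i) y ->
  {for y, continuous (fun y => invmx (metric i y) k l)}.
Proof.
move=> yD.
by have [] := @C1_inv_metric _ _ _ _ (@open_image i) (@smooth_metric i) (@unit_metric i) k l _ yD.
Qed.

End Manifold.

(** * Slices, gradient and curvature on the product *)

Section Product.
Context {R : realType} {v w : nat}.
Variables (V : riemannian_data R v) (W : riemannian_data R w).
Hypotheses (hV : is_riemannian_manifold V) (hW : is_riemannian_manifold W).
Let M := riemannian_product V W.

Lemma partials_lshift (s : seq 'I_v) (F : 'rV[R]_(v + w) -> R) (b : 'rV[R]_w) :
  partials s (fun a => F (row_mx a b)) =
  (fun a => partials (map (@lshift v w) s) F (row_mx a b)).
Proof.
elim: s => [//|i s ih] /=; rewrite -/(partials s _) ih; apply/funext => a.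
by rewrite partial_lshift row_mxKl row_mxKr.
Qed.

Lemma partials_rshift (s : seq 'I_w) (F : 'rV[R]_(v + w) -> R) (a : 'rV[R]_v) :
  partials s (fun b => F (row_mx a b)) =
  (fun b => partials (map (@rshift v w) s) F (row_mx a b)).
Proof.
elim: s => [//|i s ih] /=; rewrite -/(partials s _) ih; apply/funext => b.
by rewrite partial_rshift row_mxKl row_mxKr.
Qed.

Lemma derivable_lshift (F : 'rV[R]_(v + w) -> R) a b i :
  derivable F (row_mx a b) (delta_mx 0 (lshift w i)) ->
  derivable (fun a => F (row_mx a b)) a (delta_mx 0 i).
Proof.
have E : (fun h : R => h^-1 *: ((F \o shift (row_mx a b)) (h *: delta_mx 0 (lshift w i)) - F (row_mx a b)))
  = (fun h : R => h^-1 *: (((fun a => F (row_mx a b)) \o shift a) (h *: delta_mx 0 i) - F (row_mx a b))).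
  apply/funext => h /=; congr (_ *: (F _ - _)).
  rewrite (_ : delta_mx 0 (lshift w i) = row_mx (delta_mx 0 i) 0).
    by rewrite scale_row_mx add_row_mx scaler0 add0r.
  apply/rowP => k; rewrite !mxE; case: splitP => j kj; rewrite !mxE eqxx /= -val_eqE /= kj //=.
  by rewrite gtn_eqF// ltn_addr.
by rewrite /derivable E.
Qed.

Lemma derivable_rshift (F : 'rV[R]_(v + w) -> R) a b i :
  derivable F (row_mx a b) (delta_mx 0 (rshift v i)) ->
  derivable (fun b => F (row_mx a b)) b (delta_mx 0 i).
Proof.
have E : (fun h : R => h^-1 *: ((F \o shift (row_mx a b)) (h *: delta_mx 0 (rshift v i)) - F (row_mx a b)))
  = (fun h : R => h^-1 *: (((fun b => F (row_mx a b)) \o shift b) (h *: delta_mx 0 i) - F (row_mx a b))).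
  apply/funext => h /=; congr (_ *: (F _ - _)).
  rewrite (_ : delta_mx 0 (rshift v i) = row_mx 0 (delta_mx 0 i)).
    by rewrite scale_row_mx add_row_mx scaler0 add0r.
  apply/rowP => k; rewrite !mxE; case: splitP => j kj; rewrite !mxE eqxx /= -val_eqE /= kj //=.
    by rewrite ltn_eqF// ltn_addr.
  by rewrite eqn_add2l.
by rewrite /derivable E.
Qed.

Lemma image_product (i : chart_index V) (j : chart_index W) a b :
  (chart i @` dom i) a -> (chart j @` dom j) b ->
  (chart ((i, j) : chart_index M) @` dom ((i, j) : chart_index M)) (row_mx a b).
Proof. by move=> [x xi <-] [y yj <-]; exists (x, y). Qed.

Section TestFunction.
Variable u : M -> R.
Hypothesis su : smooth_function u.

Let coord (i : chart_index V) (j : chart_index W) : 'rV[R]_(v + w) -> R :=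
  u \o param ((i, j) : chart_index M).

Let coordE_l i j y : dom j y ->
  (fun x => u (x, y)) \o param i = (fun a => coord i j (row_mx a (chart j y))).
Proof.
by move=> yj; apply/funext => a; rewrite /coord /= row_mxKl row_mxKr paramK.
Qed.

Let coordE_r i j x : dom i x ->
  (fun y => u (x, y)) \o param j = (fun b => coord i j (row_mx (chart i x) b)).
Proof.
by move=> xi; apply/funext => a; rewrite /coord /= row_mxKl row_mxKr paramK.
Qed.

Lemma smooth_section_l y : smooth_function (fun x : V => u (x, y)).
Proof.
move=> i s a aD; have [j yj] := dom_chart hW y; rewrite (coordE_l i yj) partials_lshift.
have bD : (chart j @` dom j) (chart j y) by exists y.
have [c d] := su (map (@lshift v w) s) (image_product aD bD); split.
  apply: (@continuous_comp _ _ _ (fun a => row_mx a (chart j y))) => //.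
  by apply: continuous_at_row_mx => //; exact: cst_continuous.
by move=> k; apply: derivable_lshift; exact: d.
Qed.

Lemma smooth_section_r x : smooth_function (fun y : W => u (x, y)).
Proof.
move=> j s b bD; have [i xi] := dom_chart hV x; rewrite (coordE_r j xi) partials_rshift.
have aD : (chart i @` dom i) (chart i x) by exists x.
have [c d] := su (map (@rshift v w) s) (image_product aD bD); split.
  apply: (@continuous_comp _ _ _ (fun b => row_mx (chart i x) b)) => //.
  by apply: continuous_at_row_mx => //; exact: cst_continuous.
by move=> k; apply: derivable_rshift; exact: d.
Qed.

Lemma nbhs_dom_product i j (z : M) : dom i z.1 -> dom j z.2 ->
  \forall z' \near z, dom i z'.1 /\ dom j z'.2.
Proof.
move=> zi zj; exists (dom i, dom j); last by move=> z' [].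
by split; exact: nbhs_dom.
Qed.

Lemma continuous_in_product_chart (f : M -> R) (F : 'rV[R]_(v + w) -> R) i j (z : M) :
  dom i z.1 -> dom j z.2 ->
  (forall z' : M, dom i z'.1 -> dom j z'.2 -> f z' = F (row_mx (chart i z'.1) (chart j z'.2))) ->
  {for row_mx (chart i z.1) (chart j z.2), continuous F} -> {for z, continuous f}.
Proof.
move=> zi zj fF cF.
apply: (@near_eq_continuous_at _ _ (F \o fun z' : M => row_mx (chart i z'.1) (chart j z'.2))).
  by have := nbhs_dom_product zi zj; apply: filterS => z' [z'i z'j]; rewrite /= fF.
apply: continuous_comp => //; apply: continuous_at_row_mx.
  by apply: (continuous_comp (g := chart i)); [exact: cvg_fst|exact: chart_continuous].
by apply: (continuous_comp (g := chart j)); [exact: cvg_snd|exact: chart_continuous].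
Qed.

Lemma test_function_continuous : continuous u.
Proof.
move=> [x y]; have [i xi] := dom_chart hV x; have [j yj] := dom_chart hW y.
apply: (@continuous_in_product_chart _ (coord i j) i j) => //.
  by move=> [x' y'] /= xi' yj'; rewrite /coord /= row_mxKl row_mxKr !paramK.
have aD : (chart i @` dom i) (chart i x) by exists x.
have bD : (chart j @` dom j) (chart j y) by exists y.
exact: (su [::] (image_product aD bD)).1.
Qed.

Definition sqnorm_dl (z : M) : R := sqnorm_d (fun x : V => u (x, z.2)) z.1.
Definition sqnorm_dr (z : M) : R := sqnorm_d (fun y : W => u (z.1, y)) z.2.

(** Whatever product chart [xget] selects, the block diagonal inverse metric splits the form into
    the forms of the two slices, and these are independent of the charts on the factors. *)
Lemma sqnorm_d_product (z : M) : sqnorm_d u z = sqnorm_dl z + sqnorm_dr z.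
Proof.
case: z => x y.
have H i j : dom i x -> dom j y ->
    coord_sqnorm_d u ((i, j) : chart_index M) (row_mx (chart i x) (chart j y))
    = sqnorm_dl (x, y) + sqnorm_dr (x, y).
  move=> xi yj; have aD : (chart i @` dom i) (chart i x) by exists x.
  have bD : (chart j @` dom j) (chart j y) by exists y.
  rewrite /sqnorm_dl /sqnorm_dr /= (sqnorm_dE hV (smooth_section_l y) xi).
  rewrite (sqnorm_dE hW (smooth_section_r x) yj) /coord_sqnorm_d.
  rewrite (coord_sqnorm_block (@unit_metric _ _ _ hV i) (@unit_metric _ _ _ hW j)) ?row_mxKl ?row_mxKr//.
  by rewrite (coordE_l i yj) (coordE_r j xi).
rewrite /sqnorm_d; case: xgetP => [r _ [[i j] [/= xi yj] ->]|]; first exact: H.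
have [i xi] := dom_chart hV x; have [j yj] := dom_chart hW y.
by move=> /(_ (coord_sqnorm_d u ((i, j) : chart_index M) (row_mx (chart i x) (chart j y))))[]; exists (i, j).
Qed.

(** Joint continuity in both variables is what gives measurability and a uniform bound on the
    product; it comes from writing the slice derivatives as partial derivatives of the full
    coordinate expression of [u]. *)
Lemma continuous_sqnorm_dl : continuous sqnorm_dl.
Proof.
move=> [x y]; have [i xi] := dom_chart hV x; have [j yj] := dom_chart hW y.
pose F z := \sum_(k < v) \sum_(l < v) invmx (metric i (lsubmx z)) k l *
    partial (lshift w k) (coord i j) z * partial (lshift w l) (coord i j) z.
apply: (@continuous_in_product_chart _ F i j) => //.
  move=> [x' y'] /= x'i y'j; rewrite /sqnorm_dl /= (sqnorm_dE hV (smooth_section_l y') x'i).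
  rewrite /coord_sqnorm_d (coordE_l i y'j) /F row_mxKl.
  apply: eq_bigr => k _; apply: eq_bigr => l _.
  by rewrite !partial_lshift row_mxKl row_mxKr.
have aD : (chart i @` dom i) (chart i x) by exists x.
have bD : (chart j @` dom j) (chart j y) by exists y.
apply: continuous_at_sum => k; apply: continuous_at_sum => l.
have cp c : {for row_mx (chart i x) (chart j y), continuous (partial (lshift w c) (coord i j))}.
  exact: (su [:: lshift w c] (image_product aD bD)).1.
apply: continuousM => //; apply: continuousM => //.
apply: (@continuous_comp _ _ _ lsubmx (fun a => invmx (metric i a) k l)); first exact: continuous_lsubmx.
by rewrite row_mxKl; exact: (continuous_inv_metric hV).
Qed.

Lemma continuous_sqnorm_dr : continuous sqnorm_dr.
Proof.
move=> [x y]; have [i xi] := dom_chart hV x; have [j yj] := dom_chart hW y.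
pose F z := \sum_(k < w) \sum_(l < w) invmx (metric j (rsubmx z)) k l *
    partial (rshift v k) (coord i j) z * partial (rshift v l) (coord i j) z.
apply: (@continuous_in_product_chart _ F i j) => //.
  move=> [x' y'] /= x'i y'j; rewrite /sqnorm_dr /= (sqnorm_dE hW (smooth_section_r x') y'j).
  rewrite /coord_sqnorm_d (coordE_r j x'i) /F row_mxKr.
  apply: eq_bigr => k _; apply: eq_bigr => l _.
  by rewrite !partial_rshift row_mxKl row_mxKr.
have aD : (chart i @` dom i) (chart i x) by exists x.
have bD : (chart j @` dom j) (chart j y) by exists y.
apply: continuous_at_sum => k; apply: continuous_at_sum => l.
have cp c : {for row_mx (chart i x) (chart j y), continuous (partial (rshift v c) (coord i j))}.
  exact: (su [:: rshift v c] (image_product aD bD)).1.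
apply: continuousM => //; apply: continuousM => //.
apply: (@continuous_comp _ _ _ rsubmx (fun a => invmx (metric j a) k l)); first exact: continuous_rsubmx.
by rewrite row_mxKr; exact: (continuous_inv_metric hW).
Qed.

End TestFunction.

Lemma scalar_curvature_product (sV : V -> R) (sW : W -> R) (sM : M -> R) :
  is_scalar_curvature sV -> is_scalar_curvature sW -> is_scalar_curvature sM ->
  forall z : M, sM z = sV z.1 + sW z.2.
Proof.
move=> hsV hsW hsM [x y] /=.
have [i xi] := dom_chart hV x; have [j yj] := dom_chart hW y.
rewrite (hsM ((i, j) : chart_index M) (x, y) (conj xi yj)).
rewrite (@coord_scalar_curvature_block _ _ _ (metric i) (metric j) (chart i @` dom i) (chart j @` dom j));
  rewrite ?row_mxKl ?row_mxKr.
- by rewrite -(hsV _ _ xi) -(hsW _ _ yj).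
- exact: open_image.
- exact: open_image.
- exact: unit_metric.
- exact: unit_metric.
- by exists x.
- by exists y.
Qed.

End Product.

(** * Supports of slices and of their gradients *)

Section Support.
Context {R : realType} {v w : nat}.
Variables (V : riemannian_data R v) (W : riemannian_data R w).
Hypotheses (hV : is_riemannian_manifold V) (hW : is_riemannian_manifold W).
Let M := riemannian_product V W.
Variable u : M -> R.
Hypotheses (su : smooth_function u) (cu : compactly_supported u).

Let K : set M := closure [set z | u z != 0].

Lemma hausdorff_manifold n (N : riemannian_data R n) :
  is_riemannian_manifold N -> hausdorff_space N.
Proof. by case=> -[]. Qed.

Lemma compact_fst_support : compact [set z.1 | z in K].
Proof. by apply: continuous_compact => //; apply: continuous_subspaceT => z; exact: cvg_fst. Qed.

Lemma compact_snd_support : compact [set z.2 | z in K].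
Proof. by apply: continuous_compact => //; apply: continuous_subspaceT => z; exact: cvg_snd. Qed.

(** The slice is supported in the projection of the support of [u]. That projection is compact,
    hence closed in the Hausdorff space [V], so it contains the closure as well. *)
Lemma compactly_supported_section_l y : compactly_supported (fun x : V => u (x, y)).
Proof.
have cK := compact_fst_support.
apply: (subclosed_compact _ cK); first exact: closed_closure.
have /closure_id -> := compact_closed (hausdorff_manifold hV) cK.
apply: closure_subset => x /= uxy; exists (x, y) => //.
exact: subset_closure.
Qed.

Lemma compactly_supported_section_r x : compactly_supported (fun y : W => u (x, y)).
Proof.
have cK := compact_snd_support.
apply: (subclosed_compact _ cK); first exact: closed_closure.
have /closure_id -> := compact_closed (hausdorff_manifold hW) cK.
apply: closure_subset => y /= uxy; exists (x, y) => //.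
exact: subset_closure.
Qed.

Lemma near_off_support z : ~ K z -> \forall z' \near z, u z' = 0.
Proof.
move=> Kz; have oK : open (~` K) by rewrite openC; exact: closed_closure.
have := open_nbhs_nbhs (conj oK Kz); apply: filterS => z' Kz'.
by apply/eqP/negPn/negP => uz'; apply: Kz'; exact: subset_closure.
Qed.

Lemma sqnorm_d_near0 n (N : riemannian_data R n) (f : N -> R) x :
  is_riemannian_manifold N -> smooth_function f ->
  (\forall x' \near x, f x' = 0) -> sqnorm_d f x = 0.
Proof.
move=> hN sf f0; have [i xi] := dom_chart hN x.
rewrite (sqnorm_dE hN sf xi) /coord_sqnorm_d.
rewrite big1// => k _; rewrite big1// => l _.
have -> : partial l (f \o param i) (chart i x) = 0; last by rewrite mulr0.
rewrite -(@partial_cst _ _ l 0 (chart i x)); apply: near_partial.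
have xD : (chart i @` dom i) (chart i x) by exists x.
have cp : {for chart i x, continuous (param i)} by exact: (param_continuous hN xD).
by apply: (cp [set x' | f x' = 0]); rewrite (paramK hN xi).
Qed.

Lemma sqnorm_dl_off_support z : ~ K z -> sqnorm_dl u z = 0.
Proof.
move=> /near_off_support u0; apply: sqnorm_d_near0 => //; first exact: smooth_section_l.
have : {for z.1, continuous (fun x : V => (x, z.2) : M)}.
  by apply: cvg_pair; [exact: cvg_id|exact: cvg_cst].
by move=> c; apply: (c [set z' | u z' = 0]); rewrite -surjective_pairing.
Qed.

Lemma sqnorm_dr_off_support z : ~ K z -> sqnorm_dr u z = 0.
Proof.
move=> /near_off_support u0; apply: sqnorm_d_near0 => //; first exact: smooth_section_r.
have : {for z.2, continuous (fun y : W => (z.1, y) : M)}.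
  by apply: cvg_pair; [exact: cvg_cst|exact: cvg_id].
by move=> c; apply: (c [set z' | u z' = 0]); rewrite -surjective_pairing.
Qed.

End Support.

(** * The volume measure of a product *)

Import HBNNSimple.

Section UnmeasurableIntegral.
Local Open Scope ereal_scope.
Context d (T : measurableType d) (R : realType) (mu : {measure set T -> \bar R}).

(* Stated without measurability, so that they apply to the inner integrals of [rV_integral]. *)
Lemma nonneg_le_integral (f g : T -> \bar R) : (forall x, 0 <= f x) ->
  (forall x, f x <= g x) -> \int[mu]_x f x <= \int[mu]_x g x.
Proof.
move=> f0 fg; rewrite !ge0_integralTE//; last by move=> x; exact: le_trans (fg x).
apply: le_ereal_sup => _ [h hf <-]; exists h => // x.
exact: le_trans (fg x).
Qed.

Lemma nonneg_integralZl (f : T -> \bar R) (c : R) : (0 <= c)%R -> (forall x, 0 <= f x) ->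
  \int[mu]_x (c%:E * f x) = c%:E * \int[mu]_x f x.
Proof.
(* The integral is a supremum over simple functions lying below, and scaling these gives one
   inequality. The opposite one is the same fact for [c * f] and the factor [c^-1]. *)
have le_scale (k : R) (h : T -> \bar R) : (0 < k)%R -> (forall x, 0 <= h x) ->
    k%:E * \int[mu]_x h x <= \int[mu]_x (k%:E * h x).
  move=> k0 h0; have kh0 x : 0 <= k%:E * h x by rewrite mule_ge0// lee_fin ltW.
  rewrite !ge0_integralTE// -lee_pdivlMl//; apply: ge_ereal_sup => _ [s sh <-].
  rewrite lee_pdivlMl// -sintegralrM.
  apply: ereal_sup_ubound; exists (scale_nnsfun s (ltW k0)) => //.
  move=> x /=; rewrite EFinM lee_pmul2l//; exact: sh.
rewrite le_eqVlt => /predU1P[<- f0|c0 f0].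
  by under eq_integral do rewrite mul0e; rewrite integral0 mul0e.
apply/le_anti/andP; split; last exact: le_scale.
rewrite -lee_pdivrMl//.
have cf0 x : 0 <= c%:E * f x by rewrite mule_ge0// lee_fin ltW.
have ci : (0 < c^-1)%R by rewrite invr_gt0.
apply: (le_trans (le_scale _ _ ci cf0)).
under eq_integral do rewrite muleA -EFinM mulVf ?gt_eqF// mul1e.
exact: lexx.
Qed.

End UnmeasurableIntegral.

(** * Iterated integrals over row vectors *)

Section IteratedIntegral.
Local Open Scope ereal_scope.
Context {R : realType}.

Lemma rV_integral_ge0 n (f : 'rV[R]_n -> \bar R) : (forall y, 0 <= f y) ->
  0 <= rV_integral f.
Proof.
elim: n f => [|n ih] f f0 /=; first exact: f0.
by apply: integral_ge0 => t _; apply: ih => y; exact: f0.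
Qed.

Lemma le_rV_integral n (f g : 'rV[R]_n -> \bar R) : (forall y, 0 <= f y) ->
  (forall y, f y <= g y) -> rV_integral f <= rV_integral g.
Proof.
elim: n f g => [|n ih] f g f0 fg /=; first exact: fg.
apply: (@nonneg_le_integral _ _ _ (@lebesgue_measure R)) => t; first exact: rV_integral_ge0.
exact: ih.
Qed.

Lemma rV_integralZl n (f : 'rV[R]_n -> \bar R) (c : R) : (0 <= c)%R ->
  (forall y, 0 <= f y) -> rV_integral (fun y => c%:E * f y) = c%:E * rV_integral f.
Proof.
move=> c0; elim: n f => [//|n ih] f f0 /=.
rewrite -nonneg_integralZl// => [|t]; last exact: rV_integral_ge0.
by apply: eq_integral => t _; exact: ih.
Qed.

(** No order of integration is exchanged: [rV_integral] peels off coordinates from the left, so the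
    first [v] integrals are already the outer ones. *)
Lemma rV_integral_split v w (f : 'rV[R]_(v + w) -> \bar R) :
  rV_integral f = rV_integral (fun a : 'rV[R]_v => rV_integral (fun b : 'rV[R]_w => f (row_mx a b))).
Proof.
elim: v f => [|v ih] f.
  rewrite /=; congr (@rV_integral _ w); apply/funext => b; congr f.
  apply/rowP => j; rewrite mxE; case: splitP => [[]//|k jk]; congr (b _ _).
  exact/val_inj.
rewrite /=; apply: eq_integral => t _; rewrite ih; congr (@rV_integral _ v).
apply/funext => a; congr (@rV_integral _ w); apply/funext => b; congr f.
by rewrite row_mxA castmx_id.
Qed.

Lemma ball_rV n (z y : 'rV[R]_n) (e : R) : (0 < e)%R ->
  ball z e y <-> forall j, ball (z ord0 j) e (y ord0 j).
Proof.
move=> e0; split=> [[_ zy] j|zy]; first exact: zy.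
by split => // i j; rewrite !ord1.
Qed.

(** For the maximum norm a ball is a cube of side [2 * e], so its indicator is a product of
    indicators of intervals. *)
Lemma rV_integral_ball n (z : 'rV[R]_n) (e : R) : (0 < e)%R ->
  rV_integral (fun y => (\1_(ball z e) y)%:E) = ((2 * e) ^+ n)%:E.
Proof.
move=> e0; elim: n z => [|n ih] z.
  by rewrite /= indicE mem_set//; apply/ball_rV => // -[].
pose z' : 'rV[R]_n := @rsubmx _ 1 1 n z.
rewrite /= (_ : (fun t => _) = fun t => (\1_(ball (z ord0 ord0) e) t)%:E * ((2 * e) ^+ n)%:E).
  rewrite (_ : (fun t => _) = fun t => ((2 * e) ^+ n)%:E * (\1_(ball (z ord0 ord0) e) t)%:E).
    rewrite nonneg_integralZl; last first.
    - by move=> t; rewrite lee_fin.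
    - by rewrite exprn_ge0// mulr_ge0// ltW.
    rewrite integral_indic//; last exact: measurable_ball.
    rewrite setIT [X in _ * X](lebesgue_measure_ball _ (ltW e0)).
    by rewrite -EFinM exprSr; congr (_ * _)%:E; rewrite mulr_natl.
  by apply/funext => t; rewrite muleC.
apply/funext => t; rewrite -(ih z') -rV_integralZl.
- congr (@rV_integral _ n); apply/funext => y; rewrite -EFinM; congr (_%:E).
  rewrite !indicE -natrM mulnb; congr (nat_of_bool _)%:R.
  apply/idP/andP => [/set_mem/(ball_rV _ _ e0) zy|[/set_mem zt /set_mem/(ball_rV _ _ e0) zy]].
    split; apply/mem_set; first by have := zy ord0; rewrite mxE; case: splitP => // k _; rewrite (ord1 k) mxE eqxx.
    apply/ball_rV => // j; rewrite mxE; have := zy (rshift 1 j).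
    by rewrite (@row_mxEr _ 1 1 n).
  apply/mem_set/ball_rV => // j; case: (@split_ordP 1 n j) => k ->.
    rewrite (@row_mxEl _ 1 1 n) (ord1 k) mxE eqxx.
    by rewrite (_ : @lshift 1 n _ = ord0)//; exact/val_inj.
  by rewrite (@row_mxEr _ 1 1 n); have := zy k; rewrite mxE.
- by rewrite indicE; case: (_ \in _).
- by move=> y; rewrite lee_fin.
Qed.

End IteratedIntegral.

(** * Local finiteness and positivity of the volume measure *)

Section Volume.
Context {R : realType} {n : nat}.
Variable N : riemannian_data R n.
Hypothesis hN : is_riemannian_manifold N.
Variable vol : {measure set (borel N) -> \bar R}.
Hypothesis hvol : is_volume_measure vol.

Lemma borel_open (A : set N) : open A -> measurable (A : set (borel N)).
Proof. by move=> oA; exact: sub_sigma_algebra. Qed.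

Lemma borel_closed (A : set N) : closed A -> measurable (A : set (borel N)).
Proof.
move=> cA; rewrite -(setCK A); apply: measurableC; apply: borel_open.
by rewrite openC.
Qed.

Let rho (i : chart_index N) y := Num.sqrt (\det (metric i y)).

Let continuous_rho i y : (chart i @` dom i) y -> {for y, continuous (rho i)}.
Proof.
move=> yD; apply: (@continuous_comp _ _ _ (fun y => \det (metric i y)) Num.sqrt).
  apply: continuous_at_det => k l; by have [] := @smooth_metric _ _ _ hN i k l [::] _ yD.
exact: sqrt_continuous.
Qed.

(** Source of both estimates on the volume: a coordinate cube around [x] on which the density lies
    between positive constants. The upper bound gives neighbourhoods of finite volume, the lower one
    positive volume of nonempty open sets. *)
Lemma volume_box (x : N) (A : set N) : nbhs x A ->
  exists i e c C, [/\ dom i x, 0 < e, 0 < c, ball (chart i x) e `<=` chart i @` (dom i `&` A) &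
     forall y, ball (chart i x) e y -> c <= Num.sqrt (\det (metric i y)) <= C].
Proof.
move=> nA; have [i xi] := dom_chart hN x.
have xD : (chart i @` dom i) (chart i x) by exists x.
have r0 : 0 < rho i (chart i x).
  by rewrite sqrtr_gt0; apply/posdefmx_det_gt0; exact: (posdef_metric hN).
have near1 := open_nbhs_nbhs (conj (@open_image _ _ _ hN i) xD).
have near2 : nbhs (chart i x) (param i @^-1` A).
  have cp : {for chart i x, continuous (param i)} by exact: (param_continuous hN).
  by apply: cp; rewrite (paramK hN xi).
have near3 : \forall y \near chart i x, rho i (chart i x) / 2 <= rho i y <= rho i (chart i x) * 2.
  have h2 : 0 < rho i (chart i x) / 2 by rewrite divr_gt0.
  have := continuous_rho xD; move/cvgr_distC_le => /(_ _ h2).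
  apply: filterS => y; rewrite ler_norml => /andP[]; lra.
have /nbhs_ballP[e /= e0 He] : nbhs (chart i x) ((chart i @` dom i) `&` (param i @^-1` A `&`
    [set y | rho i (chart i x) / 2 <= rho i y <= rho i (chart i x) * 2])).
  exact: filterI near1 (filterI near2 near3).
exists i, e, (rho i (chart i x) / 2), (rho i (chart i x) * 2); split => //.
- by rewrite divr_gt0.
- move=> y /He[[x' x'i <-]] [/=]; rewrite (paramK hN x'i) => x'A _.
  by exists x'.
- by move=> y /He[_ []].
Qed.

Lemma volume_finite_nbhd (x : N) : exists U : set (borel N),
  [/\ @open N U, U x, (vol U < +oo)%E & exists i, U `<=` dom i].
Proof.
have [i [e [c [C [xi e0 c0 _ hC]]]]] := @volume_box x setT filterT.
exists (dom i `&` chart i @^-1` ball (chart i x) e).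
have oU : @open N (dom i `&` chart i @^-1` ball (chart i x) e).
  rewrite openE => z [zi zb]; apply: filterI; first exact: nbhs_dom.
  have cz : {for z, continuous (chart i)} by exact: (chart_continuous hN).
  by apply: cz; apply: open_nbhs_nbhs; split => //; exact: ball_open.
split => //.
- split => //; exact: ballxx.
- rewrite (@hvol i _ (borel_open oU)); last by move=> z [].
  apply: (@le_lt_trans _ _ (C%:E * ((2 * e) ^+ n)%:E)%E); last exact: ltry.
  have C0 : 0 <= C.
    by have /hC/andP[cr rC] := @ballxx _ _ (chart i x) e e0; lra.
  rewrite -(rV_integral_ball (chart i x) e0) -rV_integralZl//.
  apply: le_rV_integral => y; first by rewrite lee_fin mulr_ge0// sqrtr_ge0.
  rewrite -EFinM lee_fin !indicE.
  case: (boolP (y \in _)) => [/set_mem[z [zi zb] zy]|_]; last first.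
    by rewrite mul0r mulr_ge0.
  have yb : ball (chart i x) e y by rewrite -zy.
  by rewrite mem_set// mul1r mulr1; have /andP[] := hC y yb.
- by exists i => z [].
Qed.

Lemma volume_open_gt0 (A : set (borel N)) : @open N A -> A !=set0 -> (0 < vol A)%E.
Proof.
move=> oA [x Ax].
have [i [e [c [C [xi e0 c0 bA hC]]]]] := @volume_box x A (open_nbhs_nbhs (conj oA Ax)).
have oU : @open N (dom i `&` A) by apply: openI => //; exact: open_dom.
apply: (@lt_le_trans _ _ (vol (dom i `&` A))); last first.
  by apply: le_measure; rewrite ?inE; [exact: borel_open|exact: borel_open|move=> z []].
rewrite (@hvol i _ (borel_open oU)); last by move=> z [].
apply: (@lt_le_trans _ _ (c%:E * ((2 * e) ^+ n)%:E)%E).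
  by rewrite -EFinM lte_fin mulr_gt0// exprn_gt0// mulr_gt0.
rewrite -(rV_integral_ball (chart i x) e0) -rV_integralZl ?(ltW c0)//.
apply: le_rV_integral => y; first by rewrite -EFinM lee_fin mulr_ge0// ltW.
rewrite -EFinM lee_fin !indicE.
case: (boolP (y \in (ball (chart i x) e : set _))) => [/set_mem yb|_]; last first.
  by rewrite mulr0 mulr_ge0// sqrtr_ge0.
rewrite mem_set; last exact: bA.
by rewrite mul1r mulr1; have /andP[] := hC y yb.
Qed.

(** A finite subcover by neighbourhoods of finite volume. *)
Lemma volume_compact_lty (K : set (borel N)) : @compact N K -> (vol K < +oo)%E.
Proof.
move=> cK.
have mK : measurable K by apply: borel_closed; apply: compact_closed => //; exact: hausdorff_manifold.
pose U x : set (borel N) := xget set0 [set U : set (borel N) | [/\ @open N U, U x, (vol U < +oo)%E & exists i, U `<=` dom i]].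
have HU x : [/\ @open N (U x), U x x, (vol (U x) < +oo)%E & exists i, U x `<=` dom i].
  rewrite /U; case: xgetP => [B _ //|]; have [B HB] := volume_finite_nbhd x.
  by move=> /(_ B).
move: (cK); rewrite compact_cover => /(_ N setT U)[].
- by move=> x _; have [] := HU x.
- by move=> x _; exists x => //; have [] := HU x.
move=> D _ KD.
have [D' fD' KD'] : exists2 D' : set N, finite_set D' & K `<=` \bigcup_(x in D') U x.
  by eexists; [exact: (finite_fset D)|exact: KD].
apply: (le_lt_trans (content_sub_fsum vol fD' _ mK KD')).
  by move=> x _; apply: borel_open; have [] := HU x.
rewrite fsbig_finite//; apply: lte_sum_pinfty => x _.
by have [] := HU x.
Qed.

(** Those members of a countable base that have finite volume and lie in one chart domain already
    cover the space; subtracting the earlier ones makes them disjoint. *)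
Lemma volume_exhaustion : exists E : nat -> set (borel N),
  [/\ forall k, measurable (E k), trivIset setT E, \bigcup_k E k = setT,
     forall k, (vol (E k) < +oo)%E & forall k, exists i, E k `<=` dom i].
Proof.
have [B cB [oB bB]] : @second_countable N by case: hN => -[].
pose good (U : set (borel N)) := (vol U < +oo)%E /\ exists i, U `<=` dom i.
have Bgood x : exists U, [/\ B U, U x & good U].
  have [A [oA Ax Afin [i Ai]]] := volume_finite_nbhd x.
  have [U [BU Ux] UA] := bB x _ (open_nbhs_nbhs (conj oA Ax)).
  exists U; split => //; split; last by exists i; exact: subset_trans Ai.
  apply: le_lt_trans Afin; apply: le_measure; rewrite ?inE//; apply: borel_open => //.
  exact: oB.
have [e eB] : exists e : nat -> set N, B `<=` range e.
  have [->|[e]] := pfcard_geP cB; first by exists (fun=> set0).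
  by exists e => U BU; have [k _ <-] := 'surj_e BU; exists k.
pose E k : set (borel N) := if pselect (B (e k) /\ good (e k)) then e k else set0.
have mE k : measurable (E k).
  by rewrite /E; case: pselect => [H|_] /=; [apply: borel_open; exact: oB H.1|exact: measurable0].
have gE k : good (E k).
  rewrite /E; case: pselect => [H|_] /=; [exact: H.2|split]; first by rewrite measure0.
  (* The empty set must also sit in some chart domain; one exists because the space is pointed. *)
  by have [i _] := dom_chart hN point; exists i.
exists (seqDU E); split.
- by move=> k; apply: measurableD => //; apply: bigsetU_measurable => j _.
- exact: trivIset_seqDU.
- rewrite -seqDU_bigcup_eq; apply/seteqP; split => // x _.
  have [U [BU Ux gU]] := Bgood x; have [k _ ek] := eB _ BU.
  exists k => //; rewrite /E; case: pselect => [H|] /=; first by rewrite ek.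
  by rewrite ek => H; apply: H.
- move=> k; apply: le_lt_trans (gE k).1; apply: le_measure; rewrite ?inE//.
    by apply: measurableD => //; apply: bigsetU_measurable => j _.
  exact: subDsetl.
- by move=> k; have [_ [i Ei]] := gE k; exists i; apply: subset_trans Ei; exact: subDsetl.
Qed.

End Volume.

Lemma measurable_continuous (T U : ptopologicalType) (f : T -> U) : continuous f ->
  measurable_fun setT (f : g_sigma_algebraType (@open T) -> g_sigma_algebraType (@open U)).
Proof.
move=> /continuousP cf; apply: (measurability (@open U : set (set (g_sigma_algebraType (@open U))))) => //.
move=> _ [B oB <-]; rewrite setTI.
by apply: sub_sigma_algebra; exact: cf.
Qed.

Lemma measurable_continuous_R (R : realType) (T : ptopologicalType) (f : T -> R) : continuous f ->
  measurable_fun setT (f : g_sigma_algebraType (@open T) -> R).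
Proof.
move=> /continuousP cf; apply: (measurability _ (RGenOpens.measurableE R)) => //.
move=> _ [B [a [b ->]] <-]; rewrite setTI.
by apply: sub_sigma_algebra; apply: cf; exact: interval_open.
Qed.

Section SigmaFiniteMeasure.
Context d (T : measurableType d) (R : realType).

(** Product measures and Tonelli's theorem take bundled sigma-finite measures, whereas here
    sigma-finiteness is a proved proposition. The alias carries the proof [h], so that the structure
    can be attached to it. *)
Definition sigma_finite_alias (mu : {measure set T -> \bar R})
  (h : sigma_finite setT mu) : set T -> \bar R := mu.

Variables (mu : {measure set T -> \bar R}) (h : sigma_finite setT mu).

HB.instance Definition _ := Measure.copy (sigma_finite_alias h) mu.
HB.instance Definition _ := Measure_isSigmaFinite.Build _ _ _ (sigma_finite_alias h) h.

Lemma sigma_finite_measureE :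
  exists nu : {sigma_finite_measure set T -> \bar R}, nu = mu :> (set T -> \bar R).
Proof. by exists (sigma_finite_alias h). Qed.

End SigmaFiniteMeasure.

(** The factor [c] may be infinite: it will be the volume of an arbitrary Borel set. *)
Lemma nneseriesZr (R : realType) (f : nat -> \bar R) (c : \bar R) :
  (forall i, (0 <= f i)%E) -> (0 <= c)%E ->
  (\sum_(0 <= i <oo) (f i * c) = (\sum_(0 <= i <oo) f i) * c)%E.
Proof.
move=> f0; case: c => [c| |//] c0.
  rewrite muleC -nneseriesZl//; by apply: eq_eseriesr => i _; rewrite muleC.
have [[i fi]|fi] := pselect (exists i, (0 < f i)%E).
  rewrite [RHS]gt0_muley; last first.
    apply: (lt_le_trans fi); rewrite (@nneseriesD1 _ _ i)//; apply: leeDl.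
    by apply: nneseries_ge0 => k _ _.
  apply: (@nneseries_pinfty _ _ _ i) => //; last by rewrite gt0_muley.
  by move=> k _; rewrite mule_ge0.
have f_eq0 i : f i = 0%E.
  apply/le_anti; rewrite f0 andbT leNgt; apply/negP => fi0.
  by apply: fi; exists i.
rewrite !eseries0 ?mul0e// => i _ _; by rewrite f_eq0 ?mul0e.
Qed.

(** * Volume of rectangles *)

Section ProductVolume.
Context {R : realType} {v w : nat}.
Variables (V : riemannian_data R v) (W : riemannian_data R w).
Hypotheses (hV : is_riemannian_manifold V) (hW : is_riemannian_manifold W).
Let M := riemannian_product V W.
Variables (volV : {measure set (borel V) -> \bar R})
  (volW : {measure set (borel W) -> \bar R})
  (volM : {measure set (borel M) -> \bar R}).
Hypotheses (hvolV : is_volume_measure volV) (hvolW : is_volume_measure volW)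
  (hvolM : is_volume_measure volM).

Lemma borel_product_rectangle (A : set (borel V)) (B : set (borel W)) :
  measurable A -> measurable B -> measurable (A `*` B : set (borel M)).
Proof.
move=> mA mB; have -> : A `*` B = (fst @^-1` A) `&` (snd @^-1` B) by [].
apply: measurableI.
- have := @measurable_continuous M V fst _; rewrite -[X in measurable X]setTI; apply => //.
  by move=> z; exact: cvg_fst.
- have := @measurable_continuous M W snd _; rewrite -[X in measurable X]setTI; apply => //.
  by move=> z; exact: cvg_snd.
Qed.

(** In the product chart the determinant of the block diagonal metric is the product of the two
    determinants and the indicator factors too, so the iterated integral separates. Finiteness lets
    each volume be pulled out as a real constant. *)
Lemma volume_chart_rectangle (A : set (borel V)) (B : set (borel W)) i j :
  measurable A -> measurable B -> A `<=` dom i -> B `<=` dom j ->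
  (volV A < +oo)%E -> (volW B < +oo)%E -> volM (A `*` B) = (volV A * volW B)%E.
Proof.
move=> mA mB Ai Bj finA finB.
rewrite (@hvolM (i, j) _ (borel_product_rectangle mA mB)); last first.
  by move=> z [zA zB]; split; [exact: Ai|exact: Bj].
rewrite rV_integral_split.
pose fA y := (\1_(chart i @` A) y * Num.sqrt (\det (metric i y)))%:E.
pose fB y := (\1_(chart j @` B) y * Num.sqrt (\det (metric j y)))%:E.
have fA0 y : (0 <= fA y)%E by rewrite lee_fin mulr_ge0// sqrtr_ge0.
have fB0 y : (0 <= fB y)%E by rewrite lee_fin mulr_ge0// sqrtr_ge0.
have vA : volV A = rV_integral fA by exact: hvolV.
have vB : volW B = rV_integral fB by exact: hvolW.
transitivity (rV_integral (fun a => rV_integral (fun b => (fA a * fB b)%E))); last first.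
  transitivity (rV_integral (fun a => (fine (volW B))%:E * fA a)%E); last first.
    rewrite rV_integralZl ?fine_ge0// -vA fineK; first by rewrite muleC.
    by rewrite ge0_fin_numE.
  congr rV_integral; apply/funext => a; rewrite rV_integralZl//.
  by rewrite -vB fineK ?ge0_fin_numE// muleC.
congr rV_integral; apply/funext => a; congr rV_integral; apply/funext => b.
rewrite /fA /fB -EFinM; congr (_%:E).
rewrite !indicE.
have [aA|aA] := boolP (a \in chart i @` A); last first.
  rewrite mul0r mul0r (_ : (row_mx a b \in _) = false) ?mul0r//.
  apply/negbTE; apply: contra aA => /set_mem[[x y] [xA yB] /= /eq_row_mx[<- _]].
  by apply/mem_set; exists x.
have [bB|bB] := boolP (b \in chart j @` B); last first.
  rewrite mul0r mulr0 (_ : (row_mx a b \in _) = false) ?mul0r//.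
  apply/negbTE; apply: contra bB => /set_mem[[x y] [xA yB] /= /eq_row_mx[_ <-]].
  by apply/mem_set; exists y.
rewrite mem_set ?mul1r; last first.
  by move: aA bB => /set_mem[x xA <-] /set_mem[y yB <-]; exists (x, y).
rewrite /= row_mxKl row_mxKr det_ublock sqrtrM//.
have aD : (chart i @` dom i) a by move/set_mem : aA => [x xA <-]; exists x => //; exact: Ai.
by apply/ltW/posdefmx_det_gt0; exact: (posdef_metric hV).
Qed.

(** Both sides are countably additive, so the rectangle is cut along exhaustions of the two factors
    into cells of finite volume, each inside a single product chart. *)
Lemma volume_rectangle (A : set (borel V)) (B : set (borel W)) :
  measurable A -> measurable B -> volM (A `*` B) = (volV A * volW B)%E.
Proof.
move=> mA mB.
have [E [mE tE cE finE domE]] := volume_exhaustion hV hvolV.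
have [F [mF tF cF finF domF]] := volume_exhaustion hW hvolW.
have fin_sub n (N : riemannian_data R n) (mu : {measure set (borel N) -> \bar R}) (C D : set (borel N)) :
    measurable C -> measurable D -> (mu D < +oo)%E -> (mu (C `&` D) < +oo)%E.
  move=> mC mD; apply: le_lt_trans; apply: le_measure; rewrite ?inE//.
  exact: measurableI.
have decomp n (N : riemannian_data R n) (mu : {measure set (borel N) -> \bar R})
    (G : nat -> set (borel N)) (C : set (borel N)) : (forall k, measurable (G k)) ->
    trivIset setT G -> \bigcup_k G k = setT -> measurable C ->
    mu C = (\sum_(0 <= k <oo) mu (C `&` G k))%E.
  move=> mG tG cG mC; rewrite -{1}(setIT C) -cG setI_bigcupr measure_semi_bigcup//.
  - by move=> k; exact: measurableI.
  - exact: trivIset_setIl.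
  - by apply: bigcup_measurable => k _; exact: measurableI.
pose G k : set (borel M) := E k `*` setT.
pose H k : set (borel M) := setT `*` F k.
have mG k : measurable (G k) by apply: borel_product_rectangle.
have mH k : measurable (H k) by apply: borel_product_rectangle.
have tG : trivIset setT G.
  apply/trivIsetP => k l _ _ kl; apply/seteqP; split => // -[x y] [[/= xk _] [/= xl _]].
  have : (E k `&` E l) x by [].
  by move/trivIsetP : tE => /(_ k l I I kl) ->.
have tH : trivIset setT H.
  apply/trivIsetP => k l _ _ kl; apply/seteqP; split => // -[x y] [[/= _ yk] [/= _ yl]].
  have : (F k `&` F l) y by [].
  by move/trivIsetP : tF => /(_ k l I I kl) ->.
have cG : \bigcup_k G k = setT.
  apply/seteqP; split => // -[x y] _; have : setT x by [].
  by rewrite -cE => -[k _ xk]; exists k.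
have cH : \bigcup_k H k = setT.
  apply/seteqP; split => // -[x y] _; have : setT y by [].
  by rewrite -cF => -[k _ yk]; exists k.
rewrite (decomp _ M volM G)//; last exact: borel_product_rectangle.
rewrite (decomp _ V volV E)// -nneseriesZr//; apply: eq_eseriesr => k _.
rewrite (decomp _ W volW F)//.
have finEk := fin_sub _ _ volV _ _ mA (mE k) (finE k).
rewrite -[X in (X * _)%E]fineK ?ge0_fin_numE// -nneseriesZl//.
rewrite (decomp _ M volM H)//; last first.
  by apply: measurableI => //; exact: borel_product_rectangle.
apply: eq_eseriesr => l _; rewrite fineK ?ge0_fin_numE//.
have [i Ei] := domE k; have [j Fj] := domF l.
rewrite -(@volume_chart_rectangle _ _ i j).
- congr (volM _); apply/seteqP; split => -[x y] /=.
    by move=> [[[? ?] [? _]] [_ ?]].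
  by move=> [[? ?] [? ?]].
- exact: measurableI.
- exact: measurableI.
- by move=> x [_ /Ei].
- by move=> x [_ /Fj].
- by [].
- exact: (fin_sub _ _ volW _ _ mB (mF l) (finF l)).
Qed.

End ProductVolume.

(** * Identification with the product measure *)

Section BorelProduct.
Context {R : realType} {v w : nat}.
Variables (V : riemannian_data R v) (W : riemannian_data R w).
Hypotheses (hV : is_riemannian_manifold V) (hW : is_riemannian_manifold W).
Let M := riemannian_product V W.

Lemma countable_base n (N : riemannian_data R n) : is_riemannian_manifold N ->
  exists e : nat -> set N, (forall k, open (e k)) /\
    forall x (A : set N), nbhs x A -> exists k, e k x /\ e k `<=` A.
Proof.
case=> -[_ [B cB [oB bB]] _ _ _] _.
have [BE|[f]] := pfcard_geP cB.
  exists (fun=> set0); split=> [k|x A nA]; first exact: open0.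
  by have [U [+ _] _] := bB x _ nA; rewrite BE.
exists f; split=> [k|x A nA]; first by apply: oB; exact: funS.
have [U [BU Ux] UA] := bB x _ nA; have [k _ fk] := 'surj_f BU.
by exists k; rewrite fk.
Qed.

(** Second countability of the factors makes every open set of the product a countable union of open
    rectangles, so Borel sets of the product topology belong to the product sigma-algebra. *)
Lemma open_measurable_product (O : set (V * W)) : open O ->
  measurable (O : set (borel V * borel W)%type).
Proof.
move=> oO; have [e [oe be]] := countable_base hV; have [f [of_ bf]] := countable_base hW.
pose Q (p : nat * nat) : set (borel V * borel W)%type :=
  if pselect (e p.1 `*` f p.2 `<=` O) then e p.1 `*` f p.2 else set0.
have -> : (O : set (borel V * borel W)%type) = \bigcup_k \bigcup_l Q (k, l).
  apply/seteqP; split => [[x y] Oxy|[x y] [k _ [l _]]]; last first.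
    by rewrite /Q; case: pselect => [H|_] /=; [move=> h; exact: (H (x, y) h)|].
  have [[A B] [/= nA nB] ABO] := open_nbhs_nbhs (conj oO Oxy).
  have [k [ekx ekA]] := be _ _ nA; have [l [fly flB]] := bf _ _ nB.
  exists k => //; exists l => //; rewrite /Q; case: pselect => [_|H] /=; first by [].
  by apply: H => -[x' y'] [/= x'e y'f]; apply: ABO; split; [exact: ekA|exact: flB].
apply: bigcup_measurable => k _; apply: bigcup_measurable => l _.
rewrite /Q; case: pselect => [_|_] /=; last exact: measurable0.
by apply: measurableX; apply: borel_open.
Qed.

Lemma measurable_continuous_product (f : V * W -> R) : continuous f ->
  measurable_fun setT (f : (borel V * borel W)%type -> R).
Proof.
move=> /continuousP cf; apply: (measurability _ (RGenOpens.measurableE R)) => //.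
move=> _ [B [a [b ->]] <-]; rewrite setTI.
by apply: open_measurable_product; apply: cf; exact: interval_open.
Qed.

Lemma measurable_id_product :
  measurable_fun setT (id : borel M -> (borel V * borel W)%type).
Proof.
apply/measurable_fun_pairP; split.
  by apply: (@measurable_continuous M V fst) => z; exact: cvg_fst.
by apply: (@measurable_continuous M W snd) => z; exact: cvg_snd.
Qed.

Variables (volV : {measure set (borel V) -> \bar R})
  (volW : {measure set (borel W) -> \bar R})
  (volM : {measure set (borel M) -> \bar R}).
Hypotheses (hvolV : is_volume_measure volV) (hvolW : is_volume_measure volW)
  (hvolM : is_volume_measure volM).
Variables (nuV : {sigma_finite_measure set (borel V) -> \bar R})
  (nuW : {sigma_finite_measure set (borel W) -> \bar R}).
Hypotheses (nuVE : nuV = volV :> (set (borel V) -> \bar R))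
  (nuWE : nuW = volW :> (set (borel W) -> \bar R)).

(** The measure [volM] lives on the Borel sets of the product topology. Pushed along the identity to
    the product sigma-algebra it has the right values on rectangles, and uniqueness of the product
    measure concludes. *)
Lemma ge0_integral_volume_product (f : (borel V * borel W)%type -> \bar R) :
  measurable_fun setT f -> (forall z, (0 <= f z)%E) ->
  (\int[volM]_z f z = \int[nuV \x nuW]_z f z)%E.
Proof.
move=> mf f0.
pose push : {measure set (borel V * borel W)%type -> \bar R} :=
  measure_function_pushforward__canonical__measure_function_Measure volM measurable_id_product.
transitivity (\int[push]_z f z)%E.
  by rewrite (ge0_integral_pushforward measurable_id_product).
apply: eq_measure_integral => X mX _; apply/esym.
apply: product_measure_unique => // A B mA mB.
by rewrite nuVE nuWE; exact: (volume_rectangle hV hW).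
Qed.

Lemma integral_volume_product (f : (borel V * borel W)%type -> \bar R) :
  measurable_fun setT f ->
  (\int[volM]_z f z = \int[nuV \x nuW]_z f z)%E.
Proof.
move=> mf; rewrite integralE [RHS]integralE.
rewrite ge0_integral_volume_product//; last exact: measurable_funepos.
by rewrite ge0_integral_volume_product//; exact: measurable_funeneg.
Qed.

End BorelProduct.

Lemma sigma_finite_volume (R : realType) n (N : riemannian_data R n)
  (vol : {measure set (borel N) -> \bar R}) : is_riemannian_manifold N ->
  is_volume_measure vol -> sigma_finite setT vol.
Proof.
move=> hN hvol; have [E [mE _ cE finE _]] := volume_exhaustion hN hvol.
by exists E.
Qed.

Lemma bounded_integrable d (T : measurableType d) (R : realType)
  (mu : {measure set T -> \bar R}) (K : set T) (f : T -> R) (C : R) :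
  measurable K -> (mu K < +oo)%E -> measurable_fun setT f ->
  (forall x, `|f x| <= C) -> (forall x, ~ K x -> f x = 0) ->
  mu.-integrable setT (EFin \o f).
Proof.
move=> mK finK mf fC f0.
apply: (@le_integrable _ _ _ _ setT measurableT _ (fun x => C%:E * (\1_K x)%:E)%E).
- exact/measurable_EFinP.
- move=> x _ /=; rewrite indicE lee_fin.
  have [xK|xK] := boolP (x \in K); first by rewrite mulr1 (le_trans (fC x))// ler_norm.
  by rewrite f0 ?mulr0//; apply: contraNnot xK; exact: mem_set.
- apply: integrableZl => //; apply/integrableP; split.
    by apply/measurable_EFinP; exact: measurable_indic.
  rewrite (eq_integral (fun x => (\1_K x)%:E)); last first.
    by move=> x _; rewrite gee0_abs// lee_fin.
  by rewrite integral_indic// setIT.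
Qed.

Lemma compact_support_bounded (R : realType) (T : topologicalType) (K : set T) (f : T -> R) :
  compact K -> continuous f -> (forall x, ~ K x -> f x = 0) ->
  exists C, forall x, `|f x| <= C.
Proof.
move=> cK cf f0.
have [KE|/set0P K0] := eqVneq K set0.
  by exists 0 => x; rewrite f0 ?normr0// KE.
have cf' : {within K, continuous (fun x => `|f x|)}.
  apply: continuous_subspaceT => x; apply: (continuous_comp (cf x)); exact: norm_continuous.
have [c _ Hc] := compact_EVT_max K0 cK cf'.
exists `|f c| => x; have [xK|xK] := pselect (K x); first by apply: Hc; exact: mem_set.
by rewrite f0// normr0.
Qed.

(** * Mixed norms *)

Section Interpolation.
Local Open Scope ereal_scope.
Context {R : realType}.

(** Young's inequality for the conjugate exponents [s^-1] and [(1 - s)^-1], applied to [x ^ s] and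
    [y ^ (1 - s)]. *)
Lemma young_powR (s x y : R) : (0 < s < 1)%R -> (0 <= x)%R -> (0 <= y)%R ->
  (x `^ s * y `^ (1 - s) <= s * x + (1 - s) * y)%R.
Proof.
move=> /andP[s0 s1] x0 y0.
have s1' : (0 < 1 - s)%R by rewrite subr_gt0.
have := @conjugate_powR R (x `^ s)%R (y `^ (1 - s))%R (s^-1)%R ((1 - s)^-1)%R (powR_ge0 _ _) (powR_ge0 _ _).
rewrite !invrK -!powRrM !mulfV ?gt_eqF// !powRr1// !invr_gt0 [(x * s)%R]mulrC [(y * _)%R]mulrC.
by apply=> //; rewrite addrC subrK.
Qed.

Lemma young_poweR (s : R) (x y : \bar R) : (0 < s < 1)%R -> 0 <= x -> 0 <= y ->
  x `^ s * y `^ (1 - s) <= s%:E * x + (1 - s)%:E * y.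
Proof.
move=> s01; have /andP[s0 s1] := s01.
have s1' : (0 < 1 - s)%R by rewrite subr_gt0.
case: x => [x| |//] x0; case: y => [y| |//] y0.
- rewrite !poweR_EFin -!EFinM -EFinD lee_fin; exact: young_powR.
- by rewrite gt0_muley ?lte_fin// addey ?leey// -EFinM.
- by rewrite gt0_muley ?lte_fin// addye ?leey// -EFinM.
- by rewrite !gt0_muley ?lte_fin// leey.
Qed.

(** Integrate the weighted mean inequality for [F] and [G] normalized by their integrals [A] and
    [B]. This form, with convex weights and values in the extended reals, can be applied directly to
    inner integrals that may be infinite. *)
Lemma hoelder_convex d (T : measurableType d) (mu : {measure set T -> \bar R})
    (F G : T -> \bar R) (s : R) : (0 < s < 1)%R ->
  measurable_fun setT F -> measurable_fun setT G ->
  (forall x, 0 <= F x) -> (forall x, 0 <= G x) ->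
  \int[mu]_x (F x `^ s * G x `^ (1 - s)) <=
  (\int[mu]_x F x) `^ s * (\int[mu]_x G x) `^ (1 - s).
Proof.
move=> s01; have /andP[s0 s1] := s01.
have s1' : (0 < 1 - s)%R by rewrite subr_gt0.
move=> mF mG F0 G0.
have mFG : measurable_fun setT (fun x => F x `^ s * G x `^ (1 - s)).
  by apply: emeasurable_funM; exact: measurableT_comp (measurable_poweR _) _.
set A := \int[mu]_x F x; set B := \int[mu]_x G x.
have A0 : 0 <= A by exact: integral_ge0.
have B0 : 0 <= B by exact: integral_ge0.
(* Normalization requires [A] and [B] positive and finite. If one vanishes, the integrand on the
   left is zero almost everywhere; if one is infinite and the other positive, the right-hand side is
   infinite. *)
have aezero (H : T -> \bar R) : measurable_fun setT H -> (forall x, 0 <= H x) ->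
    \int[mu]_x H x = 0 -> ae_eq mu setT H (cst 0).
  move=> mH H0 IH; apply/ae_eq_integral_abs => //.
  by under eq_integral do rewrite gee0_abs//.
have [AE|An0] := eqVneq A 0.
  rewrite (ge0_ae_eq_integral (g := cst 0))//; last first.
  - apply: filterS (aezero F mF F0 AE) => x /(_ I) -> _.
    by rewrite poweR0r ?gt_eqF// mul0e.
  - by move=> x _; rewrite mule_ge0// poweR_ge0.
  by rewrite integral0 mule_ge0// poweR_ge0.
have [BE|Bn0] := eqVneq B 0.
  rewrite (ge0_ae_eq_integral (g := cst 0))//; last first.
  - apply: filterS (aezero G mG G0 BE) => x /(_ I) -> _.
    by rewrite poweR0r ?gt_eqF// mule0.
  - by move=> x _; rewrite mule_ge0// poweR_ge0.
  by rewrite integral0 mule_ge0// poweR_ge0.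
have Agt0 : 0 < A by rewrite lt0e An0.
have Bgt0 : 0 < B by rewrite lt0e Bn0.
have [AE|AN] := eqVneq A +oo.
  by rewrite AE poweRyr ?gt_eqF// gt0_mulye ?leey// poweR_gt0.
have [BE|BN] := eqVneq B +oo.
  by rewrite BE poweRyr ?gt_eqF// gt0_muley ?leey// poweR_gt0.
have Afin : A \is a fin_num by rewrite ge0_fin_numE// ltey.
have Bfin : B \is a fin_num by rewrite ge0_fin_numE// ltey.
pose a := fine A; pose b := fine B.
have AE : A = a%:E by rewrite fineK.
have BE : B = b%:E by rewrite fineK.
have a0 : (0 < a)%R by rewrite -lte_fin -AE.
have b0 : (0 < b)%R by rewrite -lte_fin -BE.
pose c := (a `^ s * b `^ (1 - s))%R.
have c0 : (0 <= c)%R by rewrite mulr_ge0// powR_ge0.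
have mFa : measurable_fun setT (fun x => (s / a)%:E * F x) by exact: measurable_funeM.
have mGb : measurable_fun setT (fun x => ((1 - s) / b)%:E * G x) by exact: measurable_funeM.
have sa0 : (0 <= s / a)%R by rewrite divr_ge0// ltW.
have sb0 : (0 <= (1 - s) / b)%R by rewrite divr_ge0// ltW.
have Fa0 x : 0 <= (s / a)%:E * F x by rewrite mule_ge0.
have Gb0 x : 0 <= ((1 - s) / b)%:E * G x by rewrite mule_ge0.
apply: (@le_trans _ _ (\int[mu]_x (c%:E * ((s / a)%:E * F x + ((1 - s) / b)%:E * G x)))).
  apply: ge0_le_integral => //.
  - by move=> x _; rewrite mule_ge0// poweR_ge0.
  - by apply: measurable_funeM; exact: emeasurable_funD.
  - move=> x _.
    have ai0 : (0 <= a^-1)%R by rewrite invr_ge0 ltW.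
    have bi0 : (0 <= b^-1)%R by rewrite invr_ge0 ltW.
    have aF0 : 0 <= a^-1%:E * F x by rewrite mule_ge0.
    have bG0 : 0 <= b^-1%:E * G x by rewrite mule_ge0.
    have := young_poweR s01 aF0 bG0.
    rewrite poweRM// (poweRM (1 - s))// !poweR_EFin muleACA -EFinM => H.
    have : c%:E * ((a^-1 `^ s * b^-1 `^ (1 - s))%:E * (F x `^ s * G x `^ (1 - s))) <=
        c%:E * (s%:E * (a^-1%:E * F x) + (1 - s)%:E * (b^-1%:E * G x)).
      by rewrite lee_wpmul2l.
    rewrite !muleA -!EFinM; congr (_ <= _).
    suff -> : (c * (a^-1 `^ s * b^-1 `^ (1 - s)) = 1)%R by rewrite mul1e.
    rewrite /c mulrACA -powRM ?(ltW a0)// -powRM ?(ltW b0)// !mulfV ?gt_eqF//.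
    by rewrite !powR1 mulr1.
rewrite ge0_integralZl//; last 2 first.
- exact: emeasurable_funD.
- by move=> x _; rewrite adde_ge0.
rewrite ge0_integralD// (ge0_integralZl _ measurableT mF)// (ge0_integralZl _ measurableT mG)//.
rewrite -/A -/B AE BE !poweR_EFin.
change ((c * (s / a * a + (1 - s) / b * b))%:E <= c%:E).
by rewrite lee_fin !divfK ?gt_eqF// addrC subrK mulr1.
Qed.

Section TwoMeasures.
Context d1 d2 (T1 : measurableType d1) (T2 : measurableType d2).
Variables (m1 : {sigma_finite_measure set T1 -> \bar R})
  (m2 : {sigma_finite_measure set T2 -> \bar R}).

Let measurable_poweR_comp d (T : measurableType d) (G : T -> \bar R) (r : R) :
  measurable_fun setT G -> measurable_fun setT (fun z => G z `^ r).
Proof. by move=> mG; exact: measurableT_comp (measurable_poweR _) mG. Qed.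

(** With [H] the inner integral, write [H ^ q = H ^ (q - 1) * H], exchange the integrals and apply
    Hoelder's inequality in [y] for each [x]. This gives I <= I ^ (1 - 1/q) * J; finiteness of I
    allows the division by I ^ (1 - 1/q). *)
Lemma minkowski_integral (F : T1 * T2 -> \bar R) (q : R) :
  measurable_fun setT F -> (forall z, 0 <= F z) -> (1 < q)%R ->
  \int[m2]_y (\int[m1]_x F (x, y)) `^ q < +oo ->
  (\int[m2]_y (\int[m1]_x F (x, y)) `^ q) `^ q^-1 <=
  \int[m1]_x (\int[m2]_y F (x, y) `^ q) `^ q^-1.
Proof.
move=> mF F0.
have mFr r : measurable_fun setT (fun z => F z `^ r) by exact: measurable_poweR_comp.
move=> q1; have q0 : (0 < q)%R by exact: lt_trans q1.
pose H y := \int[m1]_x F (x, y); set I := \int[m2]_y _ => Ifin.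
set J := \int[m1]_x _.
have H0 y : 0 <= H y by exact: integral_ge0.
have mH : measurable_fun setT H by exact: (measurable_fun_fubini_tonelli_G F).
have mHr r : measurable_fun setT (fun y => H y `^ r).
  exact: measurable_poweR_comp.
have mJ : measurable_fun setT (fun x => \int[m2]_y F (x, y) `^ q).
  by apply: (measurable_fun_fubini_tonelli_F (fun z => F z `^ q)) => // z; exact: poweR_ge0.
have I0 : 0 <= I by apply: integral_ge0 => y _; exact: poweR_ge0.
have J0 : 0 <= J by apply: integral_ge0 => x _; exact: poweR_ge0.
have [IE|In0] := eqVneq I 0.
  by rewrite IE poweR0r ?invr_eq0 ?gt_eqF.
have Igt0 : 0 < I by rewrite lt0e In0.
have qV01 : (0 < q^-1 < 1)%R by rewrite invr_gt0 q0 invf_lt1.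
have IJ : I <= I `^ (1 - q^-1) * J.
  have IE : I = \int[m2]_y \int[m1]_x (H y `^ (q - 1) * F (x, y)).
    apply: eq_integral => y _; rewrite -/(H y).
    rewrite ge0_integralZl//; last 2 first.
    - by move: mF => /(measurableT_comp)/(_ (pair2_measurable y)).
    - exact: poweR_ge0.
    rewrite -[X in _ = _ * X]/(H y) -[X in _ = _ * X](poweRe1 (H0 y)) -poweRD ?subrK//.
    by apply: add_neq0_poweRD_def; rewrite subrK gt_eqF.
  rewrite {1}IE -(fubini_tonelli (fun z => H z.2 `^ (q - 1) * F z))//; last 2 first.
  - apply: emeasurable_funM => //.
    by apply: (measurableT_comp (mHr _)); exact: measurable_snd.
  - by move=> z; rewrite mule_ge0// poweR_ge0.
  rewrite /= -ge0_integralZl//; last 3 first.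
  - exact: measurable_poweR_comp.
  - by move=> x _; exact: poweR_ge0.
  - exact: poweR_ge0.
  apply: ge0_le_integral => //.
  - by move=> x _; apply: integral_ge0 => y _; rewrite mule_ge0// poweR_ge0.
  - apply: (measurable_fun_fubini_tonelli_F (fun z => H z.2 `^ (q - 1) * F z)) => [|z].
      apply: emeasurable_funM => //.
      by apply: (measurableT_comp (mHr _)); exact: measurable_snd.
    by rewrite mule_ge0// poweR_ge0.
  - by apply: emeasurable_funM => //; exact: measurable_poweR_comp.
  - move=> x _.
    rewrite [leRHS]muleC.
    apply: le_trans (hoelder_convex m2 qV01 _ (mHr q) _ _); last 3 first.
    - by move: (mFr q) => /(measurableT_comp)/(_ (pair1_measurable x)).
    - by move=> y; exact: poweR_ge0.
    - by move=> y; exact: poweR_ge0.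
    apply: ge0_le_integral => //.
    + by move=> y _; rewrite mule_ge0// poweR_ge0.
    + apply: emeasurable_funM => //.
      by move: mF => /(measurableT_comp)/(_ (pair1_measurable x)).
    + apply: emeasurable_funM; apply: measurableT_comp (measurable_poweR _) _ => //.
      by move: (mFr q) => /(measurableT_comp)/(_ (pair1_measurable x)).
    + move=> y _; rewrite -!poweRrM mulfV ?gt_eqF// poweRe1// muleC.
      by rewrite mulrBr mulr1 mulfV ?gt_eqF.
have Ifn : I \is a fin_num by rewrite ge0_fin_numE.
have IE : I = I `^ q^-1 * I `^ (1 - q^-1).
  have q1E : (q^-1 + (1 - q^-1) = 1)%R by rewrite addrC subrK.
  rewrite -poweRD; first by rewrite q1E poweRe1.
  by apply: add_neq0_poweRD_def; rewrite q1E oner_eq0.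
move: IJ; rewrite {1}IE muleC lee_pmul2l//.
  by rewrite fin_num_poweR.
exact: poweR_gt0.
Qed.

(* Hoelder's inequality in [x], between the exponents [p v] and [2], and then in [y]
   bounds the [p m]-norm by the right-hand side with the norm of the finiteness hypothesis
   in place of the last factor; Minkowski's inequality exchanges the order of the two
   norms in that factor. *)
Lemma mixed_norm_interpolation (F : T1 * T2 -> \bar R) (v w : R) :
  measurable_fun setT F -> (forall z, 0 <= F z) -> (2 < v)%R -> (2 < w)%R ->
  let m := (v + w)%R in
  let p n : R := (2 * n / (n - 2))%R in
  \int[m2]_y (\int[m1]_x F (x, y) `^ 2) `^ (p w / 2) < +oo ->
  (\int[m1 \x m2]_z F z `^ p m) `^ (2 / p m) <=
  (\int[m2]_y (\int[m1]_x F (x, y) `^ p v) `^ (2 / p v)) `^ (v / m) *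
  (\int[m1]_x (\int[m2]_y F (x, y) `^ p w) `^ (2 / p w)) `^ (w / m).
Proof.
move=> mF F0 v2 w2 m p.
have mFr r : measurable_fun setT (fun z => F z `^ r) by exact: measurable_poweR_comp.
have v0 : (0 < v)%R by lra.
have w0 : (0 < w)%R by lra.
have m0 : (0 < m)%R by rewrite /m; lra.
have vm2 : (0 < v - 2)%R by lra.
have wm2 : (0 < w - 2)%R by lra.
have mm2 : (0 < m - 2)%R by rewrite /m; lra.
have p0 n : (2 < n)%R -> (0 < p n)%R.
  by move=> n2; rewrite /p divr_gt0//; [lra|rewrite subr_gt0].
pose q := (p w / 2)%R; rewrite -/q.
set I := \int[m2]_y _ `^ q => Ifin.
set A := \int[m2]_y _; set B := \int[m1]_x (_ `^ _).
have qE : q = (w / (w - 2))%R by rewrite /q /p; field; rewrite ?gt_eqF.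
have q1 : (1 < q)%R by rewrite qE ltr_pdivlMr// mul1r; lra.
have q0 : (0 < q)%R by lra.
(* [s] solves [p v * s + 2 * (1 - s) = p m], for Hoelder's inequality in [x]. Then [r], for the one
   in [y], solves [2 / p v * r = s], and [q * (1 - r) = 1 - s] holds as well. *)
pose s := ((v - 2) / (m - 2))%R.
pose r := (v / (m - 2))%R.
have s01 : (0 < s < 1)%R.
  by rewrite /s divr_gt0//= ltr_pdivrMr// mul1r /m; lra.
have r01 : (0 < r < 1)%R.
  by rewrite /r divr_gt0//= ltr_pdivrMr// mul1r /m; lra.
have I0 : 0 <= I by apply: integral_ge0 => y _; exact: poweR_ge0.
have A0 : 0 <= A by apply: integral_ge0 => y _; exact: poweR_ge0.
have B0 : 0 <= B by apply: integral_ge0 => y _; exact: poweR_ge0.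
have mint r' : measurable_fun setT (fun y => \int[m1]_x F (x, y) `^ r').
  by apply: (measurable_fun_fubini_tonelli_G (fun z => F z `^ r')) => // z; exact: poweR_ge0.
have int0 r' y : 0 <= \int[m1]_x F (x, y) `^ r'.
  by apply: integral_ge0 => x _; exact: poweR_ge0.
have le_poweR (x y : \bar R) (t : R) : (0 <= t)%R -> 0 <= x -> x <= y -> x `^ t <= y `^ t.
  move=> t0 x0 xy; apply: gt0_ler_poweR => //; rewrite in_itv /= ?leey ?andbT//.
  exact: le_trans xy.
have IB : I `^ q^-1 <= B.
  have q2 : (2 * q = p w)%R by rewrite /q mulrCA divff ?mulr1.
  have -> : B = \int[m1]_x (\int[m2]_y (F (x, y) `^ 2) `^ q) `^ q^-1.
    have qi : (2 / p w = q^-1)%R by rewrite /q [RHS]invf_div.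
    rewrite /B qi; apply: eq_integral => x _; congr (_ `^ _).
    by apply: eq_integral => y _; rewrite -poweRrM q2.
  apply: (@minkowski_integral (fun z => F z `^ 2)) => // z; exact: poweR_ge0.
have XAI : \int[m1 \x m2]_z F z `^ p m <= A `^ r * I `^ (1 - r).
  rewrite fubini_tonelli2//; last by move=> z; exact: poweR_ge0.
  apply: le_trans (hoelder_convex m2 r01 _ _ _ _).
  - apply: ge0_le_integral => //.
    + by move=> y _; exact: int0.
    + exact: mint.
    + by apply: emeasurable_funM; do 2 apply: measurable_poweR_comp; exact: mint.
    + move=> y _; rewrite /fubini_G -!poweRrM.
      have -> : (2 / p v * r = s)%R.
        by rewrite /p /r /s; field; rewrite ?gt_eqF.
      have -> : (q * (1 - r) = 1 - s)%R.
        by rewrite qE /r /s /m; field; rewrite ?gt_eqF.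
      apply: le_trans (hoelder_convex m1 s01 _ _ _ _).
      * rewrite le_eqVlt; apply/orP; left; apply/eqP; apply: eq_integral => x _.
        have pE : (p v * s + 2 * (1 - s) = p m)%R.
          by rewrite /p /s /m; field; rewrite ?gt_eqF.
        rewrite -!poweRrM -poweRD ?pE//.
        by apply: add_neq0_poweRD_def; rewrite pE gt_eqF// p0// /m; lra.
      * by move: (mFr (p v)) => /(measurableT_comp)/(_ (pair2_measurable y)).
      * by move: (mFr 2%R) => /(measurableT_comp)/(_ (pair2_measurable y)).
      * by move=> x; exact: poweR_ge0.
      * by move=> x; exact: poweR_ge0.
  - by apply: measurable_poweR_comp; exact: mint.
  - by apply: measurable_poweR_comp; exact: mint.
  - by move=> y; exact: poweR_ge0.
  - by move=> y; exact: poweR_ge0.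
have pm0 : (0 < p m)%R by apply: p0; rewrite /m; lra.
have X0 : 0 <= \int[m1 \x m2]_z F z `^ p m by apply: integral_ge0 => z _; exact: poweR_ge0.
apply: le_trans (le_poweR _ _ (2 / p m)%R _ X0 XAI) _; first by rewrite divr_ge0// ltW.
rewrite poweRM ?poweR_ge0// -!poweRrM.
(* The outer power [2 / p m] turns the Hoelder weights into [v / m] and [w / m], up to the factor
   [q^-1] consumed by Minkowski's inequality. *)
have -> : (r * (2 / p m) = v / m)%R by rewrite /p /r; field; rewrite ?gt_eqF.
have -> : ((1 - r) * (2 / p m) = q^-1 * (w / m))%R.
  by rewrite /p /r qE /m; field; rewrite ?gt_eqF.
apply: lee_pmul; rewrite ?poweR_ge0// [in leLHS]poweRrM.
by apply: le_poweR => //; [rewrite divr_ge0// ltW|exact: poweR_ge0].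
Qed.

End TwoMeasures.

End Interpolation.

(** * Energy on a product *)

Section PowerIntegral.
Context {R : realType} d (T : measurableType d) (mu : {measure set T -> \bar R}).
Variables (f : T -> R) (p : R).
Hypothesis mf : measurable_fun setT f.

Lemma measurable_norm_powR : measurable_fun setT (fun x => `|f x| `^ p).
Proof. by apply: (measurableT_comp (measurable_powR p)); exact: measurableT_comp. Qed.

Lemma integrable_norm_powR (K : set T) (C : R) : 0 < p -> measurable K -> (mu K < +oo)%E ->
  (forall x, `|f x| <= C) -> (forall x, ~ K x -> f x = 0) ->
  mu.-integrable setT (EFin \o (fun x => `|f x| `^ p)).
Proof.
move=> p0 mK finK fC f0; apply: (@bounded_integrable _ _ _ _ K _ (C `^ p)) => //.
- exact: measurable_norm_powR.
- move=> x; rewrite ger0_norm ?powR_ge0// ge0_ler_powR ?nnegrE ?(ltW p0)//.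
  exact: le_trans (fC x).
- by move=> x /f0 ->; rewrite normr0 powR0// gt_eqF.
Qed.

Lemma integral_norm_powR_gt0 (U : set T) : measurable U -> (0 < mu U)%E ->
  (forall x, U x -> f x != 0) -> (0 < \int[mu]_x (`|f x| `^ p)%:E)%E.
Proof.
move=> mU Upos fU.
rewrite lt0e integral_ge0 ?andbT; last by move=> x _; rewrite lee_fin powR_ge0.
apply/eqP => I0.
have mfp : measurable_fun setT (fun x => (`|f x| `^ p)%:E).
  by apply/measurable_EFinP; exact: measurable_norm_powR.
have : (\int[mu]_x `|(`|f x| `^ p)%:E| = 0)%E.
  by under eq_integral do rewrite gee0_abs ?lee_fin ?powR_ge0//.
move/(ae_eq_integral_abs mu measurableT mfp) => [N [mN N0 HN]].
have UN : U `<=` N.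
  move=> x Ux; apply: HN => /= /(_ I) [/powR_eq0_eq0/normr0_eq0 fx0].
  by have := fU x Ux; rewrite fx0 eqxx.
have : (mu U <= mu N)%E by apply: le_measure; rewrite ?inE.
by rewrite N0 leNgt Upos.
Qed.

End PowerIntegral.

(** * The Yamabe inequality for a single function *)

Section YamabeBound.
Context {R : realType} {n : nat}.
Hypothesis n3 : (3 <= n)%N.

Lemma natr_dim_gt2 : (2 : R) < n%:R.
Proof. by rewrite ltr_nat. Qed.

Lemma p_gt0 : 0 < p_ n :> R.
Proof. by have := natr_dim_gt2 => h; rewrite /p_ divr_gt0//; lra. Qed.

Lemma a_gt0 : 0 < a_ n :> R.
Proof. by have := natr_dim_gt2 => h; rewrite /a_ divr_gt0//; lra. Qed.

Variables (N : riemannian_data R n) (vol : {measure set (borel N) -> \bar R}) (s : N -> R).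
Hypotheses (hN : is_riemannian_manifold N) (hvol : is_volume_measure vol).

Lemma test_function_off_support (u : N -> R) x : ~ closure [set x | u x != 0] x -> u x = 0.
Proof. by move=> h; apply/eqP/negPn/negP => ux; apply: h; exact: subset_closure. Qed.

Lemma integrable_test_function_powR (u : N -> R) (p : R) : smooth_function u -> compactly_supported u ->
  0 < p -> vol.-integrable setT (fun x : borel N => (`|u x| `^ p)%:E).
Proof.
move=> su cu p0; have cont := smooth_function_continuous hN su.
have [C uC] := compact_support_bounded cu cont (@test_function_off_support u).
have mu_ : measurable_fun setT (u : borel N -> R) by exact: measurable_continuous_R.
have mS : measurable (closure [set x | u x != 0] : set (borel N)).
  by apply: borel_closed; exact: closed_closure.
apply: (integrable_norm_powR mu_ p0 mS _ uC); first exact: volume_compact_lty.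
exact: test_function_off_support.
Qed.

(** The quotient is cleared of its denominator so that the inequality also covers the zero function:
    slices of a nonzero function on the product may vanish identically, and then both sides are
    0. *)
Lemma yamabe_bound (u : N -> R) (c : R) : smooth_function u -> compactly_supported u ->
  (c%:E <= yamabe_constant vol s)%E ->
  c * (\int[vol]_x (`|u x| `^ p_ n)) `^ (2 / p_ n) <=
  \int[vol]_x (a_ n * sqnorm_d u x + s x * u x ^+ 2).
Proof.
move=> su cu cY; have p0 := p_gt0.
have [[x ux]|u0] := pselect (exists x, u x != 0); last first.
  have uE x : u x = 0 by apply/eqP/negPn/negP => ux; apply: u0; exists x.
  have -> : (\int[vol]_x (a_ n * sqnorm_d u x + s x * u x ^+ 2)) = 0.
    rewrite /Rintegral integral0_eq// => x _; rewrite uE expr0n /= mulr0 addr0.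
    rewrite (sqnorm_d_near0 hN)// ?mulr0//.
    by near=> z; exact: uE.
  rewrite /Rintegral integral0_eq; first by rewrite /= powR0 ?mulr0// mulf_neq0 ?invr_eq0 ?gt_eqF.
  by move=> x _; rewrite uE normr0 powR0// gt_eqF.
have cont := smooth_function_continuous hN su.
have I0 : 0 < \int[vol]_x (`|u x| `^ p_ n).
  have Ifin := integrable_fin_num measurableT (integrable_test_function_powR su cu p0).
  rewrite /Rintegral fine_gt0// ltey_eq Ifin andbT.
  have oU : open [set x | u x != 0].
    by move/continuousP : cont => /(_ [set r | r != 0]); apply; exact: open_neq.
  have mu_ : measurable_fun setT (u : borel N -> R) by exact: measurable_continuous_R.
  apply: (integral_norm_powR_gt0 _ mu_ (borel_open oU)) => //.
  by apply: (volume_open_gt0 hN hvol) => //; exists x.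
have D0 : 0 < (\int[vol]_x (`|u x| `^ p_ n)) `^ (2 / p_ n) by exact: powR_gt0.
rewrite -ler_pdivlMr// -lee_fin; apply: (le_trans cY).
by apply: ereal_inf_lbound; exists u => //; split => //; exists x.
Unshelve. all: by end_near. Qed.

End YamabeBound.

(** * The product inequality for abstract sigma-finite measures *)

Section ProductInequality.
Context {R : realType} d1 d2 (T1 : measurableType d1) (T2 : measurableType d2).
Variables (m1 : {sigma_finite_measure set T1 -> \bar R})
  (m2 : {sigma_finite_measure set T2 -> \bar R}).
Variables (K1 : set T1) (K2 : set T2).
Hypotheses (mK1 : measurable K1) (mK2 : measurable K2)
  (finK1 : (m1 K1 < +oo)%E) (finK2 : (m2 K2 < +oo)%E).

Let integrable_section1 (f : T1 * T2 -> R) C y : measurable_fun setT f ->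
  (forall z, `|f z| <= C) -> (forall z, ~ (K1 `*` K2) z -> f z = 0) ->
  m1.-integrable setT (fun x => (f (x, y))%:E).
Proof.
move=> mf fC f0; apply: (@bounded_integrable _ _ _ m1 K1 (fun x => f (x, y)) C) => //.
- exact: measurableT_comp.
- by move=> x Kx; apply: f0 => -[].
Qed.

Let integrable_section2 (f : T1 * T2 -> R) C x : measurable_fun setT f ->
  (forall z, `|f z| <= C) -> (forall z, ~ (K1 `*` K2) z -> f z = 0) ->
  m2.-integrable setT (fun y => (f (x, y))%:E).
Proof.
move=> mf fC f0; apply: (@bounded_integrable _ _ _ m2 K2 (fun y => f (x, y)) C) => //.
- exact: measurableT_comp.
- by move=> y Ky; apply: f0 => -[].
Qed.

Let finK : ((m1 \x m2) (K1 `*` K2) < +oo)%E.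
Proof.
rewrite product_measure1E//; apply: lte_mul_pinfty => //.
by rewrite ge0_fin_numE.
Qed.

Lemma integrable_bounded_product (f : T1 * T2 -> R) C : measurable_fun setT f ->
  (forall z, `|f z| <= C) -> (forall z, ~ (K1 `*` K2) z -> f z = 0) ->
  (m1 \x m2)%E.-integrable setT (EFin \o f).
Proof.
move=> mf fC f0; apply: (@bounded_integrable _ _ _ (m1 \x m2)%E (K1 `*` K2) f C) => //.
exact: measurableX.
Qed.

(** [f] stands for the test function, [el] and [er] for the energy densities of its slices along the
    first and second factor, [e] for the energy density on the product. All are bounded and vanish
    off a rectangle of finite measure, hence integrable. *)
Variables (f el er e : T1 * T2 -> R) (C : R).
Hypotheses (mf : measurable_fun setT f) (ml : measurable_fun setT el)
  (mr : measurable_fun setT er) (me : measurable_fun setT e).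
Hypotheses (fC : forall z, `|f z| <= C) (lC : forall z, `|el z| <= C)
  (rC : forall z, `|er z| <= C) (eC : forall z, `|e z| <= C).
Hypotheses (f0 : forall z, ~ (K1 `*` K2) z -> f z = 0)
  (l0 : forall z, ~ (K1 `*` K2) z -> el z = 0)
  (r0 : forall z, ~ (K1 `*` K2) z -> er z = 0)
  (e0 : forall z, ~ (K1 `*` K2) z -> e z = 0).

Let integrable_powR p : 0 < p ->
  (m1 \x m2)%E.-integrable setT (fun z => (`|f z| `^ p)%:E).
Proof.
move=> p0; apply: (integrable_norm_powR mf p0 (measurableX mK1 mK2) finK fC f0).
Qed.

Let measurable_f_powR p : measurable_fun setT (fun z => (`|f z| `^ p)%:E).
Proof. by apply/measurable_EFinP; exact: measurable_norm_powR. Qed.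

(* Finiteness of the mixed norm that the interpolation inequality divides by. *)
Let mixed_norm_lty q : 0 < q ->
  (\int[m2]_y (\int[m1]_x (`|f (x, y)| `^ 2)%:E) `^ q < +oo)%E.
Proof.
move=> q0.
pose D := (((C `^ 2)%:E * m1 K1) `^ q)%E.
have D0 : (0 <= D)%E by exact: poweR_ge0.
have Dfin : D \is a fin_num.
  apply: fin_num_poweR; rewrite fin_numM//; last by rewrite ge0_fin_numE.
apply: (@le_lt_trans _ _ (\int[m2]_y (D * (\1_K2 y)%:E))%E); last first.
  rewrite ge0_integralZl//; last first.
    by apply/measurable_EFinP; exact: measurable_indic.
  by rewrite integral_indic// setIT lte_mul_pinfty.
apply: ge0_le_integral => //.
- by move=> y _; exact: poweR_ge0.
- apply: (measurableT_comp (measurable_poweR _)).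
  apply: (@measurable_fun_fubini_tonelli_G _ _ _ _ _ m1 (fun z => (`|f z| `^ 2)%:E)) => //.
- apply: emeasurable_funM; first exact: measurable_cst.
  by apply/measurable_EFinP; exact: measurable_indic.
move=> y _; rewrite indicE; have [yK|yK] := boolP (y \in K2); last first.
  rewrite mule0 integral0_eq; first by rewrite poweR0r ?gt_eqF.
  move=> x _; rewrite f0 ?normr0 ?powR0 ?pnatr_eq0//.
  by move=> -[_ /= /mem_set]; apply/negP.
rewrite mule1; apply: gt0_ler_poweR; rewrite ?in_itv/= ?leey ?andbT ?(ltW q0)//.
- by apply: integral_ge0 => x _; rewrite lee_fin powR_ge0.
- by rewrite mule_ge0// lee_fin powR_ge0.
apply: (@le_trans _ _ (\int[m1]_x ((C `^ 2)%:E * (\1_K1 x)%:E))%E).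
  apply: ge0_le_integral => //.
  - by apply/measurable_EFinP; apply: measurable_norm_powR; exact: measurableT_comp.
  - apply: emeasurable_funM; first exact: measurable_cst.
    by apply/measurable_EFinP; exact: measurable_indic.
  move=> x _; rewrite indicE; have [xK|xK] := boolP (x \in K1).
    rewrite mule1 lee_fin ge0_ler_powR ?nnegrE//.
    exact: le_trans (fC (x, y)).
  rewrite mule0 f0 ?normr0 ?powR0 ?pnatr_eq0//.
  by move=> -[/= /mem_set h _]; rewrite h in xK.
rewrite ge0_integralZl//.
- by rewrite integral_indic// setIT.
- by apply/measurable_EFinP; exact: measurable_indic.
- by rewrite lee_fin powR_ge0.
Qed.

Let fine_integral (d : measure_display) (T : measurableType d)
  (mu : {measure set T -> \bar R}) (g : T -> R) :
  mu.-integrable setT (EFin \o g) -> (\int[mu]_x (g x)%:E = (\int[mu]_x g x)%:E)%E.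
Proof. by move=> ig; rewrite /Rintegral fineK//; exact: integrable_fin_num. Qed.

Variables (v w cV cW kV kW : R).
Hypotheses (v2 : 2 < v) (w2 : 2 < w).
Hypotheses (cV0 : 0 <= cV) (cW0 : 0 <= cW) (kV0 : 0 <= kV) (kW0 : 0 <= kW).
Let m := v + w.
Let p (n : R) := 2 * n / (n - 2).

Hypothesis yamabe_l : forall y,
  cV * (\int[m1]_x (`|f (x, y)| `^ p v)) `^ (2 / p v) <= \int[m1]_x el (x, y).
Hypothesis yamabe_r : forall x,
  cW * (\int[m2]_y (`|f (x, y)| `^ p w)) `^ (2 / p w) <= \int[m2]_y er (x, y).
Hypothesis e_ge : forall z, kV * el z + kW * er z <= e z.

Let p_pos n : 2 < n -> 0 < p n.
Proof. by move=> n2; rewrite /p divr_gt0//; [lra|rewrite subr_gt0]. Qed.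

(** The slice inequalities integrated over the second factor. The mixed norm remains
    extended-valued, as Tonelli's theorem and the interpolation require; the energy, which may
    change sign, is handled by Fubini's theorem. *)
Let energy_l_ge : (cV%:E * \int[m2]_y ((\int[m1]_x (`|f (x, y)| `^ p v)%:E) `^ (2 / p v)) <=
  (\int[m1 \x m2]_z el z)%:E)%E.
Proof.
have il : (m1 \x m2)%E.-integrable setT (EFin \o el) by exact: integrable_bounded_product lC l0.
have mA : measurable_fun setT
    (fun y => (\int[m1]_x (`|f (x, y)| `^ p v)%:E) `^ (2 / p v))%E.
  apply: (measurableT_comp (measurable_poweR _)).
  apply: (@measurable_fun_fubini_tonelli_G _ _ _ _ _ m1 (fun z => (`|f z| `^ p v)%:E)) => //.
rewrite -fine_integral// -(integral21_prod_meas1 il) -ge0_integralZl//; last first.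
  by move=> y _; exact: poweR_ge0.
apply: ge0_le_integral => //.
- by move=> y _; rewrite mule_ge0// poweR_ge0.
- by apply: emeasurable_funM => //; exact: measurable_cst.
- exact: (measurable_fubini_G il).
move=> y _; rewrite (fine_integral (g := fun x => `|f (x, y)| `^ p v)); last first.
  apply: (integrable_norm_powR (f := fun x => f (x, y)) _ (p_pos v2) mK1 finK1) => //.
  - exact: measurableT_comp.
  - by move=> x Kx; apply: f0 => -[].
rewrite poweR_EFin -EFinM; apply: le_trans (_ : _ <= (\int[m1]_x el (x, y))%:E)%E _.
  by rewrite lee_fin; exact: yamabe_l.
by rewrite /fubini_G -fine_integral//; exact: integrable_section1 lC l0.
Qed.

Let energy_r_ge : (cW%:E * \int[m1]_x ((\int[m2]_y (`|f (x, y)| `^ p w)%:E) `^ (2 / p w)) <=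
  (\int[m1 \x m2]_z er z)%:E)%E.
Proof.
have ir : (m1 \x m2)%E.-integrable setT (EFin \o er) by exact: integrable_bounded_product rC r0.
have mA : measurable_fun setT
    (fun x => (\int[m2]_y (`|f (x, y)| `^ p w)%:E) `^ (2 / p w))%E.
  apply: (measurableT_comp (measurable_poweR _)).
  apply: (@measurable_fun_fubini_tonelli_F _ _ _ _ _ m2 (fun z => (`|f z| `^ p w)%:E)) => //.
rewrite -fine_integral// -(integral12_prod_meas1 ir) -ge0_integralZl//; last first.
  by move=> x _; exact: poweR_ge0.
apply: ge0_le_integral => //.
- by move=> x _; rewrite mule_ge0// poweR_ge0.
- by apply: emeasurable_funM => //; exact: measurable_cst.
- exact: (measurable_fubini_F ir).
move=> x _; rewrite (fine_integral (g := fun y => `|f (x, y)| `^ p w)); last first.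
  apply: (integrable_norm_powR (f := fun y => f (x, y)) _ (p_pos w2) mK2 finK2) => //.
  - exact: measurableT_comp.
  - by move=> y Ky; apply: f0 => -[].
rewrite poweR_EFin -EFinM; apply: le_trans (_ : _ <= (\int[m2]_y er (x, y))%:E)%E _.
  by rewrite lee_fin; exact: yamabe_r.
by rewrite /fubini_F -fine_integral//; exact: integrable_section2 rC r0.
Qed.

Lemma product_energy_ge :
  (kV * cV * m / v) `^ (v / m) * (kW * cW * m / w) `^ (w / m) *
    (\int[(m1 \x m2)%E]_z (`|f z| `^ p m)) `^ (2 / p m) <= \int[(m1 \x m2)%E]_z e z.
Proof.
have v0 : 0 < v by exact: lt_trans v2.
have w0 : 0 < w by exact: lt_trans w2.
have m2' : 2 < m by rewrite /m; apply: (lt_trans v2); rewrite ltrDl.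
have m0 : 0 < m by exact: lt_trans m2'.
have el_ge := energy_l_ge; have er_ge := energy_r_ge.
set A := (\int[m2]_y ((\int[m1]_x (`|f (x, y)| `^ p v)%:E) `^ (2 / p v)))%E in el_ge.
set B := (\int[m1]_x ((\int[m2]_y (`|f (x, y)| `^ p w)%:E) `^ (2 / p w)))%E in er_ge.
have A0 : (0 <= A)%E by apply: integral_ge0 => *; exact: poweR_ge0.
have B0 : (0 <= B)%E by apply: integral_ge0 => *; exact: poweR_ge0.
have il := integrable_bounded_product ml lC l0.
have ir := integrable_bounded_product mr rC r0.
have ie := integrable_bounded_product me eC e0.
rewrite -lee_fin EFinM -poweR_EFin -fine_integral; last exact: integrable_powR (p_pos m2').
have mF : measurable_fun setT (fun z => `|f z|%:E).
  by apply/measurable_EFinP; exact: measurableT_comp.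
pose X := (\int[m1 \x m2]_z (`|f z| `^ p m)%:E)%E.
have key : (X `^ (2 / p m) <= A `^ (v / m) * B `^ (w / m))%E.
  have fin := @mixed_norm_lty (p w / 2) (divr_gt0 (p_pos w2) (ltr0Sn R 1)).
  have := @mixed_norm_interpolation R _ _ _ _ m1 m2 (fun z => `|f z|%:E) v w mF _ v2 w2.
  by apply => // z; rewrite lee_fin.
(* Chosen so that the weights of the mean inequality restore the given coefficients:
   [v / m * cl = kV * cV] and [w / m * cr = kW * cW]. *)
set cl := kV * cV * m / v; set cr := kW * cW * m / w.
have cl0 : 0 <= cl by rewrite /cl; do !apply: mulr_ge0 => //; rewrite ?invr_ge0 ltW.
have cr0 : 0 <= cr by rewrite /cr; do !apply: mulr_ge0 => //; rewrite ?invr_ge0 ltW.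
have vm : 0 < v / m < 1 by rewrite divr_gt0// ltr_pdivrMr// mul1r /m ltrDl.
have wm : w / m = 1 - v / m by rewrite /m; field; rewrite gt_eqF.
have young := young_poweR vm (mule_ge0 (y := A) (x := cl%:E) cl0 A0)
  (mule_ge0 (y := B) (x := cr%:E) cr0 B0).
rewrite -wm !poweRM ?lee_fin// !poweR_EFin in young.
apply: (@le_trans _ _ ((v / m)%:E * (cl%:E * A) + (w / m)%:E * (cr%:E * B))%E).
  apply: le_trans young; rewrite EFinM.
  rewrite [leRHS]muleACA; apply: lee_wpmul2l => //.
  by rewrite lee_fin mulr_ge0 ?powR_ge0.
rewrite !muleA -!EFinM.
have -> : v / m * cl = kV * cV by rewrite /cl; field; rewrite !gt_eqF.
have -> : w / m * cr = kW * cW by rewrite /cr; field; rewrite !gt_eqF.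
apply: (@le_trans _ _ (kV%:E * (\int[m1 \x m2]_z el z)%:E + kW%:E * (\int[m1 \x m2]_z er z)%:E)%E).
  by rewrite !EFinM -!muleA; apply: leeD; apply: lee_wpmul2l; rewrite ?lee_fin.
have ikl : (m1 \x m2)%E.-integrable setT (EFin \o (fun z => kV * el z)).
  exact: (integrableZl measurableT kV il).
have ikr : (m1 \x m2)%E.-integrable setT (EFin \o (fun z => kW * er z)).
  exact: (integrableZl measurableT kW ir).
have iklr : (m1 \x m2)%E.-integrable setT (EFin \o (fun z => kV * el z + kW * er z)).
  exact: (integrableD measurableT ikl ikr).
rewrite -!EFinM -EFinD -!RintegralZl// -RintegralD//.
rewrite -!fine_integral//; apply: le_integral => //.
by move=> z _; rewrite lee_fin; exact: e_ge.
Qed.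

End ProductInequality.

Lemma continuous_energy (R : realType) (T : topologicalType) (k : R) (f g h : T -> R) :
  continuous f -> continuous g -> continuous h ->
  continuous (fun z => k * f z + g z * h z ^+ 2).
Proof.
move=> cf cg ch z; apply: (@continuousD _ R^o _ (fun z => k * f z) (fun z => g z * h z ^+ 2)).
  by apply: (@continuousM _ _ (fun=> k) f); [exact: cst_continuous|exact: cf].
apply: (@continuousM _ _ g (fun z => h z ^+ 2)); first exact: cg.
by apply: (@continuousM _ _ h h); exact: ch.
Qed.

(** * Lower bound for the Yamabe quotient on the product *)

Section ProductEnergy.
Context {R : realType} {v w : nat}.
Hypotheses (v3 : (3 <= v)%N) (w3 : (3 <= w)%N).
Variables (V : riemannian_data R v) (W : riemannian_data R w).
Hypotheses (hV : is_riemannian_manifold V) (hW : is_riemannian_manifold W).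
Let M := riemannian_product V W.
Let m := (v + w)%N.
Variables (volV : {measure set (borel V) -> \bar R})
  (volW : {measure set (borel W) -> \bar R})
  (volM : {measure set (borel M) -> \bar R}).
Hypotheses (hvolV : is_volume_measure volV) (hvolW : is_volume_measure volW)
  (hvolM : is_volume_measure volM).
Variables (sV : V -> R) (sW : W -> R) (sM : M -> R).
Hypotheses (hsV : is_scalar_curvature sV) (hsW : is_scalar_curvature sW)
  (hsM : is_scalar_curvature sM).
Hypothesis hs : forall x y, sV x / a_ v + sW y / a_ w <= (sV x + sW y) / a_ m.
Variables cV cW : R.
Hypotheses (cV0 : 0 <= cV) (cW0 : 0 <= cW).
Hypotheses (cVY : (cV%:E <= yamabe_constant volV sV)%E)
  (cWY : (cW%:E <= yamabe_constant volW sW)%E).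
Variable u : M -> R.
Hypotheses (su : smooth_function u) (cu : compactly_supported u).

Let m3 : (3 <= m)%N. Proof. by rewrite (leq_trans v3)// leq_addr. Qed.

Let K : set M := closure [set z | u z != 0].
Let KV : set (borel V) := [set z.1 | z in K].
Let KW : set (borel W) := [set z.2 | z in K].

Let mKV : measurable KV.
Proof.
apply: borel_closed; apply: compact_closed; first exact: hausdorff_manifold.
exact: (compact_fst_support cu).
Qed.
Let mKW : measurable KW.
Proof.
apply: borel_closed; apply: compact_closed; first exact: hausdorff_manifold.
exact: (compact_snd_support cu).
Qed.
Let finKV : (volV KV < +oo)%E.
Proof. by apply: volume_compact_lty => //; exact: (compact_fst_support cu). Qed.
Let finKW : (volW KW < +oo)%E.
Proof. by apply: volume_compact_lty => //; exact: (compact_snd_support cu). Qed.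

(** The support is enlarged to the rectangle of its projections, the shape that the abstract
    inequality asks for. *)
Let off_support f : (forall z, ~ K z -> f z = 0 :> R) ->
  forall z : V * W, ~ (KV `*` KW) z -> f z = 0.
Proof. by move=> f0 z Kz; apply: f0 => zK; apply: Kz; split; exists z. Qed.

Let energy_l (z : V * W) : R := a_ v * sqnorm_dl u z + sV z.1 * u z ^+ 2.
Let energy_r (z : V * W) : R := a_ w * sqnorm_dr u z + sW z.2 * u z ^+ 2.
Let energy (z : V * W) : R := a_ m * sqnorm_d (u : M -> R) z + sM z * u z ^+ 2.

Let cont_u : continuous (u : V * W -> R) := test_function_continuous hV hW su.

Let cont_sV : continuous (fun z : V * W => sV z.1).
Proof.
move=> z; apply: (@continuous_comp _ _ _ fst sV); first exact: cvg_fst.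
exact: (continuous_scalar_curvature hV hsV).
Qed.

Let cont_sW : continuous (fun z : V * W => sW z.2).
Proof.
move=> z; apply: (@continuous_comp _ _ _ snd sW); first exact: cvg_snd.
exact: (continuous_scalar_curvature hW hsW).
Qed.

Let cont_energy_l : continuous energy_l.
Proof. exact: continuous_energy (continuous_sqnorm_dl hV hW su) cont_sV cont_u. Qed.

Let cont_energy_r : continuous energy_r.
Proof. exact: continuous_energy (continuous_sqnorm_dr hV hW su) cont_sW cont_u. Qed.

Let energyE : energy = (fun z => a_ m * (sqnorm_dl u z + sqnorm_dr u z) + (sV z.1 + sW z.2) * u z ^+ 2).
Proof.
apply/funext => z; rewrite /energy (sqnorm_d_product hV hW su).
by rewrite (scalar_curvature_product hV hW hsV hsW hsM).
Qed.

Let cont_energy : continuous energy.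
Proof.
rewrite energyE; apply: continuous_energy cont_u => z.
- apply: (@continuousD _ R^o (V * W)%type (sqnorm_dl u) (sqnorm_dr u) z).
    exact: (continuous_sqnorm_dl hV hW su).
  exact: (continuous_sqnorm_dr hV hW su).
- apply: (@continuousD _ R^o (V * W)%type (fun z => sV z.1) (fun z => sW z.2) z);
    [exact: cont_sV|exact: cont_sW].
Qed.

Let u_off z : ~ K z -> u z = 0.
Proof. by move=> h; apply/eqP/negPn/negP => uz; apply: h; exact: subset_closure. Qed.

Let energy_l_off z : ~ K z -> energy_l z = 0.
Proof.
move=> Kz; rewrite /energy_l (sqnorm_dl_off_support hV hW su)// (u_off Kz).
by rewrite expr0n /= !mulr0 addr0.
Qed.
Let energy_r_off z : ~ K z -> energy_r z = 0.
Proof.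
move=> Kz; rewrite /energy_r (sqnorm_dr_off_support hV hW su)// (u_off Kz).
by rewrite expr0n /= !mulr0 addr0.
Qed.
Let energy_off z : ~ K z -> energy z = 0.
Proof.
move=> Kz; rewrite energyE (sqnorm_dl_off_support hV hW su)//.
by rewrite (sqnorm_dr_off_support hV hW su)// (u_off Kz) expr0n /= addr0 !mulr0 addr0.
Qed.

(** The factors [a_ m / a_ v] and [a_ m / a_ w] make the gradient terms agree exactly; what remains
    is the curvature hypothesis multiplied by [a_ m] and by the square of [u]. *)
Let energy_ge z : a_ m / a_ v * energy_l z + a_ m / a_ w * energy_r z <= energy z.
Proof.
have av := a_gt0 (R := R) v3; have aw := a_gt0 (R := R) w3; have am := a_gt0 (R := R) m3.
rewrite energyE /energy_l /energy_r.
have := hs z.1 z.2; rewrite ler_pdivlMr// => h.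
have u2 : 0 <= u z ^+ 2 by exact: sqr_ge0.
have := ler_wpM2r u2 h.
move: (sqnorm_dl u z) (sqnorm_dr u z) (sV z.1) (sW z.2) (u z ^+ 2) => dl dr s1 s2 U H.
have -> : a_ m / a_ v * (a_ v * dl + s1 * U) + a_ m / a_ w * (a_ w * dr + s2 * U)
  = a_ m * (dl + dr) + (s1 / a_ v + s2 / a_ w) * a_ m * U.
  by field; rewrite ?gt_eqF.
by rewrite lerD2l.
Qed.

Let p0 n : (3 <= n)%N -> 0 < p_ n :> R := @p_gt0 R n.

Let open_support : open [set z : M | u z != 0].
Proof. by move/continuousP : cont_u => /(_ [set r | r != 0]); apply; exact: open_neq. Qed.

Lemma product_quotient_ge : (exists z, u z != 0) ->
  (a_ m / a_ v * cV * m%:R / v%:R) `^ (v%:R / m%:R) *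
  (a_ m / a_ w * cW * m%:R / w%:R) `^ (w%:R / m%:R) <= yamabe_quotient volM sM u.
Proof.
move=> [z0 uz0].
have [nuV nuVE] := sigma_finite_measureE (sigma_finite_volume hV hvolV).
have [nuW nuWE] := sigma_finite_measureE (sigma_finite_volume hW hvolW).
have [Cu uC] := compact_support_bounded (T := M) cu cont_u u_off.
have [Cl lC] := compact_support_bounded (T := M) cu cont_energy_l energy_l_off.
have [Cr rC] := compact_support_bounded (T := M) cu cont_energy_r energy_r_off.
have [Ce eC] := compact_support_bounded (T := M) cu cont_energy energy_off.
pose C := Num.max (Num.max Cu Cl) (Num.max Cr Ce).
have CP z : [/\ `|u z| <= C, `|energy_l z| <= C, `|energy_r z| <= C & `|energy z| <= C].
  by rewrite /C !le_max uC lC rC eC !orbT.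
have nuKV : (nuV KV < +oo)%E by rewrite nuVE.
have nuKW : (nuW KW < +oo)%E by rewrite nuWE.
have mu_ := measurable_continuous_product hV hW cont_u.
have me_ := measurable_continuous_product hV hW cont_energy.
have finK : ((nuV \x nuW) (KV `*` KW) < +oo)%E.
  rewrite product_measure1E//; apply: lte_mul_pinfty => //.
  by rewrite ge0_fin_numE.
have := @product_energy_ge R _ _ _ _ nuV nuW KV KW mKV mKW nuKV nuKW u energy_l energy_r energy C
  mu_ (measurable_continuous_product hV hW cont_energy_l)
  (measurable_continuous_product hV hW cont_energy_r) me_
  (fun z => let: And4 h _ _ _ := CP z in h) (fun z => let: And4 _ h _ _ := CP z in h)
  (fun z => let: And4 _ _ h _ := CP z in h) (fun z => let: And4 _ _ _ h := CP z in h)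
  (off_support u_off) (off_support energy_l_off) (off_support energy_r_off)
  (off_support energy_off) v%:R w%:R cV cW (a_ m / a_ v) (a_ m / a_ w)
  (natr_dim_gt2 v3) (natr_dim_gt2 w3) cV0 cW0
  (divr_ge0 (ltW (a_gt0 m3)) (ltW (a_gt0 v3))) (divr_ge0 (ltW (a_gt0 m3)) (ltW (a_gt0 w3))).
rewrite -natrD -/m => bound.
have intV (g : borel V -> R) : \int[nuV]_x g x = \int[volV]_x g x.
  by congr fine; apply: eq_measure_integral => X _ _; exact: (congr1 (@^~ X) nuVE).
have intW (g : borel W -> R) : \int[nuW]_x g x = \int[volW]_x g x.
  by congr fine; apply: eq_measure_integral => X _ _; exact: (congr1 (@^~ X) nuWE).
have yl y : cV * (\int[nuV]_x (`|u (x, y)| `^ p_ v)) `^ (2 / p_ v) <= \int[nuV]_x energy_l (x, y).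
  rewrite !intV.
  exact: (yamabe_bound v3 hV hvolV (smooth_section_l hW su y)
    (@compactly_supported_section_l _ _ _ V W hV u cu y) cVY).
have yr x : cW * (\int[nuW]_y (`|u (x, y)| `^ p_ w)) `^ (2 / p_ w) <= \int[nuW]_y energy_r (x, y).
  rewrite !intW.
  exact: (yamabe_bound w3 hW hvolW (smooth_section_r hV su x)
    (@compactly_supported_section_r _ _ _ V W hW u cu x) cWY).
have {}bound := bound yl yr energy_ge.
have -> : yamabe_quotient volM sM u = (\int[(nuV \x nuW)%E]_z energy z) /
    (\int[(nuV \x nuW)%E]_z (`|u z| `^ p_ m)) `^ (2 / p_ m).
  rewrite /yamabe_quotient /Rintegral.
  rewrite (integral_volume_product hV hW hvolV hvolW hvolM nuVE nuWE (f := EFin \o energy)); last first.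
    exact/measurable_EFinP.
  rewrite (integral_volume_product hV hW hvolV hvolW hvolM nuVE nuWE
    (f := fun z => (`|u z| `^ p_ m)%:E))//.
  by apply/measurable_EFinP; exact: measurable_norm_powR.
rewrite ler_pdivlMr//; apply: powR_gt0.
have Ifin := integrable_fin_num measurableT
  (integrable_norm_powR mu_ (p0 m3) (measurableX mKV mKW) finK
    (fun z => let: And4 h _ _ _ := CP z in h) (off_support u_off)).
rewrite /Rintegral fine_gt0// ltey_eq Ifin andbT.
(* The denominator is positive because [u] is nonzero on an open rectangle around [z0], whose
   product measure is positive. *)
have [[A B] /= [nA nB] AB] : nbhs z0 [set z : M | u z != 0] by exact: open_nbhs_nbhs (conj open_support uz0).
have mA : measurable (A° : set (borel V)) by apply: borel_open; exact: open_interior.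
have mB : measurable (B° : set (borel W)) by apply: borel_open; exact: open_interior.
have nuA : (0 < nuV (A° : set (borel V)))%E.
  by rewrite nuVE; apply: (volume_open_gt0 hV hvolV); [exact: open_interior|exists z0.1].
have nuB : (0 < nuW (B° : set (borel W)))%E.
  by rewrite nuWE; apply: (volume_open_gt0 hW hvolW); [exact: open_interior|exists z0.2].
have nuAB : (0 < (nuV \x nuW) (A° `*` B°))%E by rewrite product_measure1E// mule_gt0.
apply: (integral_norm_powR_gt0 (p_ m) mu_ (measurableX mA mB)) => //.
 by move=> [x y] [/interior_subset Ax /interior_subset By]; exact: (AB (x, y)).
Qed.

End ProductEnergy.

Section WeightedMean.
Context {R : realType}.
Implicit Types x y z c d s t : R.

Lemma powRV y s : 0 <= y -> y^-1 `^ s = (y `^ s)^-1.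
Proof. by move=> y0; rewrite -powR_inv1// -powRrM mulN1r powRN. Qed.

(** Brings the constant from the mean inequality into the form of the theorem; the weights sum to 1,
    so the common factor [x] comes out with exponent 1. *)
Lemma powRM_weighted x y z c d s t : 0 < x -> 0 <= y -> 0 <= z -> 0 <= c -> 0 <= d ->
  s + t = 1 ->
  (x / y * c) `^ s * (x / z * d) `^ t = x / (y `^ s * z `^ t) * c `^ s * d `^ t.
Proof.
move=> x0 y0 z0 c0 d0 st; have x0' := ltW x0.
rewrite !powRM ?invr_ge0// ?mulr_ge0 ?invr_ge0// !powRV// invfM.
have xst : x `^ s * x `^ t = x by rewrite -powRD ?st ?powRr1// oner_eq0.
by rewrite -[X in _ = X * _ * _ * _]xst; ring.
Qed.

Lemma powR_weighted_expn (m v w : nat) (a b : R) : (0 < m)%N -> 0 <= a -> 0 <= b ->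
  (a `^ (v%:R / m%:R) * b `^ (w%:R / m%:R)) ^+ m = a ^+ v * b ^+ w.
Proof.
move=> m0 a0 b0; have m0' : m%:R != 0 :> R by rewrite pnatr_eq0 -lt0n.
by rewrite exprMn -!powR_mulrn ?powR_ge0// -!powRrM !divfK.
Qed.

End WeightedMean.

Lemma expyen {R : realType} n : (0 < n)%N -> ((+oo : \bar R) ^+ n = +oo)%E.
Proof.
by case: n => // n _; elim: n => [//|n IH]; rewrite expeS IH mulyy.
Qed.

(** * The inequalities for the Yamabe constant and for [yamabe_nu] *)

Section ProductYamabe.
Context {R : realType} {v w : nat}.
Hypotheses (v3 : (3 <= v)%N) (w3 : (3 <= w)%N).
Variables (V : riemannian_data R v) (W : riemannian_data R w).
Hypotheses (hV : is_riemannian_manifold V) (hW : is_riemannian_manifold W).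
Let M := riemannian_product V W.
Let m := (v + w)%N.
Variables (volV : {measure set (borel V) -> \bar R})
  (volW : {measure set (borel W) -> \bar R})
  (volM : {measure set (borel M) -> \bar R}).
Hypotheses (hvolV : is_volume_measure volV) (hvolW : is_volume_measure volW)
  (hvolM : is_volume_measure volM).
Variables (sV : V -> R) (sW : W -> R) (sM : M -> R).
Hypotheses (hsV : is_scalar_curvature sV) (hsW : is_scalar_curvature sW)
  (hsM : is_scalar_curvature sM).
Hypotheses (hmuV : (0 <= yamabe_constant volV sV)%E)
  (hmuW : (0 <= yamabe_constant volW sW)%E).
Hypothesis hs : forall x y, sV x / a_ v + sW y / a_ w <= (sV x + sW y) / a_ m.

Let m3 : (3 <= m)%N. Proof. by rewrite (leq_trans v3)// leq_addr. Qed.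

Let na_gt0 n : (3 <= n)%N -> 0 < n%:R * a_ n :> R.
Proof. by move=> n3; rewrite mulr_gt0 ?a_gt0// ltr0n (leq_trans _ n3). Qed.

Let K : R := m%:R * a_ m / ((v%:R * a_ v) `^ (v%:R / m%:R) * (w%:R * a_ w) `^ (w%:R / m%:R)).

(* Sections of a test function on the product are test functions on the factors. *)
Lemma yamabe_constant_factors (u : M -> R) : smooth_function u -> compactly_supported u ->
  (exists z, u z != 0) -> exists cV cW : R,
  [/\ 0 <= cV, 0 <= cW, yamabe_constant volV sV = cV%:E & yamabe_constant volW sW = cW%:E].
Proof.
move=> su cu [z uz].
have finV : yamabe_constant volV sV \is a fin_num.
  rewrite ge0_fin_numE//; apply: le_lt_trans (ltry _); apply: ereal_inf_lbound.
  exists (fun x => u (x, z.2)) => //; split; first exact: (smooth_section_l hW su).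
    exact: (@compactly_supported_section_l _ _ _ V W hV u cu z.2).
  by exists z.1; case: z uz.
have finW : yamabe_constant volW sW \is a fin_num.
  rewrite ge0_fin_numE//; apply: le_lt_trans (ltry _); apply: ereal_inf_lbound.
  exists (fun y => u (z.1, y)) => //; split; first exact: (smooth_section_r hV su).
    exact: (@compactly_supported_section_r _ _ _ V W hW u cu z.1).
  by exists z.2; case: z uz.
exists (fine (yamabe_constant volV sV)), (fine (yamabe_constant volW sW)).
by rewrite !fine_ge0// !fineK.
Qed.

(** The bound is proved for each quotient separately. A test function on the product forces both
    constants of the factors to be real numbers, so the comparison takes place in [R]; without any
    test function the infimum is [+oo]. *)
Lemma yamabe_constant_product_ge :
  (K%:E * yamabe_constant volV sV `^ (v%:R / m%:R) * yamabe_constant volW sW `^ (w%:R / m%:R) <=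
   yamabe_constant volM sM)%E.
Proof.
apply: le_ereal_inf_tmp => _ [u [su cu u0] <-].
have [cV [cW [cV0 cW0 VE WE]]] := yamabe_constant_factors su cu u0.
rewrite VE WE !poweR_EFin -!EFinM lee_fin.
have VY : (cV%:E <= yamabe_constant volV sV)%E by rewrite VE.
have WY : (cW%:E <= yamabe_constant volW sW)%E by rewrite WE.
apply: le_trans (product_quotient_ge v3 w3 hV hW hvolV hvolW hvolM hsV hsW hsM hs
  cV0 cW0 VY WY su cu u0).
have [av aw] := (a_gt0 (R := R) v3, a_gt0 (R := R) w3).
have [nv nw] := (na_gt0 v3, na_gt0 w3).
have n0 n : (3 <= n)%N -> n%:R != 0 :> R by move=> n3; rewrite pnatr_eq0 -lt0n (leq_trans _ n3).
have st : v%:R / m%:R + w%:R / m%:R = 1 :> R by rewrite -mulrDl -natrD divff// n0.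
rewrite /K -(powRM_weighted (na_gt0 m3) (ltW nv) (ltW nw) cV0 cW0 st) -/m.
have -> : m%:R * a_ m / (v%:R * a_ v) * cV = a_ m / a_ v * cV * m%:R / v%:R.
  by field; rewrite n0// gt_eqF.
have -> : m%:R * a_ m / (w%:R * a_ w) * cW = a_ m / a_ w * cW * m%:R / w%:R.
  by field; rewrite n0// gt_eqF.
exact: lexx.
Qed.

Lemma yamabe_nu_product_ge : (yamabe_nu volV sV * yamabe_nu volW sW <= yamabe_nu volM sM)%E.
Proof.
have kM := na_gt0 m3; have kV := na_gt0 v3; have kW := na_gt0 w3.
have m0 : (0 < m)%N by exact: leq_trans m3.
have [[u [su cu u0]]|no_test] :=
  pselect (exists u : M -> R, [/\ smooth_function u, compactly_supported u & exists z : M, u z != 0]); last first.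
  (* The infimum of the empty set is [+oo], and multiplication by a positive constant and the power
     [m] keep it so. *)
  have -> : yamabe_nu volM sM = +oo%E; last exact: leey.
  rewrite /yamabe_nu /yamabe_constant (_ : [set _ | _ in _] = set0).
    by rewrite ereal_inf0 gt0_mulye ?expyen// lte_fin invr_gt0.
  by rewrite predeqE => r; split=> [[u hu _]|//]; apply: no_test; exists u.
have [cV [cW [cV0 cW0 VE WE]]] := yamabe_constant_factors su cu u0.
have ge := yamabe_constant_product_ge.
rewrite /yamabe_nu VE WE; rewrite VE WE !poweR_EFin -!EFinM in ge.
have /fineK ME : yamabe_constant volM sM \is a fin_num.
  rewrite fin_numElt (lt_le_trans _ ge) ?ltNyr//=; apply: le_lt_trans (ltry _).
  by apply: ereal_inf_lbound; exists u.
rewrite -ME lee_fin in ge *.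
set cM := fine _ in ge *.
(* The left-hand side is the [m]-th power of the weighted geometric mean of the normalized
   constants, so it suffices to compare the bases, which is the first inequality divided by
   [m%:R * a_ m]. *)
rewrite -!EFinM -!EFin_expe -EFinM lee_fin -(powR_weighted_expn v w m0); last 2 first.
- by rewrite mulr_ge0// invr_ge0 ltW.
- by rewrite mulr_ge0// invr_ge0 ltW.
apply: lerXn2r; rewrite ?nnegrE ?mulr_ge0 ?powR_ge0 ?invr_ge0 ?(ltW kM)//.
  apply: le_trans ge; apply: mulr_ge0 (powR_ge0 _ _); apply: mulr_ge0 (powR_ge0 _ _).
  exact: divr_ge0 (ltW kM) (mulr_ge0 (powR_ge0 _ _) (powR_ge0 _ _)).
rewrite ler_pdivlMr//; apply: le_trans ge.
rewrite !powRM ?invr_ge0 ?(ltW kV) ?(ltW kW)// !powRV ?(ltW kV) ?(ltW kW)// /K invfM -/m.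
by rewrite [cV `^ _ / _ * (_ / _)]mulrACA mulrC [cV `^ _ * _ * _]mulrC !mulrA.
Qed.

End ProductYamabe.

Theorem theorem2p3 (R : realType) (v w : nat) (hv : (3 <= v)%N) (hw : (3 <= w)%N)
    (V : riemannian_data R v) (W : riemannian_data R w)
    (hV : is_riemannian_manifold V) (hW : is_riemannian_manifold W)
    (volV : {measure set (borel V) -> \bar R})
    (volW : {measure set (borel W) -> \bar R})
    (volM : {measure set (borel (riemannian_product V W)) -> \bar R})
    (hvolV : is_volume_measure volV)
    (hvolW : is_volume_measure volW)
    (hvolM : is_volume_measure volM)
    (sV : V -> R) (sW : W -> R) (sM : riemannian_product V W -> R)
    (hsV : is_scalar_curvature sV)
    (hsW : is_scalar_curvature sW)
    (hsM : is_scalar_curvature sM)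
    (hmuV : (0 <= yamabe_constant volV sV)%E)
    (hmuW : (0 <= yamabe_constant volW sW)%E)
    (hs : forall (x : V) (y : W),
      sV x / a_ v + sW y / a_ w <= (sV x + sW y) / a_ (v + w)) :
  let m := (v + w)%N in
  (((m%:R * a_ m / ((v%:R * a_ v) `^ (v%:R / m%:R)
                    * (w%:R * a_ w) `^ (w%:R / m%:R)))%R)%:E
     * (yamabe_constant volV sV) `^ (v%:R / m%:R)
     * (yamabe_constant volW sW) `^ (w%:R / m%:R)
   <= yamabe_constant volM sM)%E
  /\ (yamabe_nu volV sV * yamabe_nu volW sW <= yamabe_nu volM sM)%E.
Proof.
split.
  exact: (yamabe_constant_product_ge hv hw hV hW hvolV hvolW hvolM hsV hsW hsM hmuV hmuW hs).
exact: (yamabe_nu_product_ge hv hw hV hW hvolV hvolW hvolM hsV hsW hsM hmuV hmuW hs).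
Qed.
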